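(* Let $a\ge 3$ be an integer and let $\mathfrak g$ be the Kac-Moody Lie algebra over $\mathbb C$ with Cartan matrix $\begin{pmatrix}2&-a\\-a&2\end{pmatrix}$, with compact involution $\omega_0$. (1) Let $X$ be a nonzero element of the linear span of the real positive root vectors of $\mathfrak g$. If the length of $X$ is not $2$, then $X,\ Y=\omega_0(X),\ H=[X,Y]$ do not form an $\mathfrak{sl}_2$-triple. (2) Let $E_0,E_1$ be real positive root vectors of different types (one of $\alpha$-type and the other of $\beta$-type). Then there exist $c_0,c_1\in\mathbb C$ such that $X=c_0E_0+c_1E_1$ has length $2$ and $X,\ Y=\omega_0(X),\ H=[X,Y]$ form an $\mathfrak{sl}_2$-triple.
   Context: Let $e_i,f_i,h_i$ ($i=0,1$) be the Chevalley generators of $\mathfrak g$, $\mathfrak h=\mathbb Ch_0\oplus\mathbb Ch_1$ the Cartan subalgebra, $\alpha_0,\alpha_1$ the simple roots ($\langle h_i,\alpha_j\rangle=a_{ij}$, the entries of the Cartan matrix), $\mathfrak g_\gamma$ the root space of a root $\gamma$, and $\mathfrak n^+$ (resp. $\mathfrak n^-$) the subalgebra generated by the $e_i$ (resp. $f_i$). The compact involution $\omega_0$ is the antilinear automorphism of $\mathfrak g$ with $\omega_0(e_i)=-f_i$, $\omega_0(f_i)=-e_i$, $\omega_0(h)=-h$ for $h\in\mathfrak h_{\mathbb R}=\mathbb Rh_0\oplus\mathbb Rh_1$. An $\mathfrak{sl}_2$-triple in $\mathfrak g$ consists of nonzero elements $X\in\mathfrak n^+$, $Y\in\mathfrak n^-$,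 $H\in\mathfrak h$ with $[H,X]=2X$, $[H,Y]=-2Y$, $[X,Y]=H$. A real root is a root in the Weyl group orbit of a simple root; real root spaces are one-dimensional, and a real (positive) root vector is a nonzero element of the root space of a real (positive) root. A nonzero element $X$ of the span of real root vectors is written uniquely (up to rescaling and order) as $X=\sum_{i=0}^{n_X-1}c_iE_i$ with $c_i\in\mathbb C\setminus\{0\}$, $0\ne E_i\in\mathfrak g_{\beta_i}$, and $\beta_i$ distinct real roots; the number $n_X$ is called the length of $X$. Define $F_0=0$, $F_1=1$, $F_{k+2}=aF_{k+1}-F_k$. The positive real roots of $\mathfrak g$ are exactly the roots $F_{k+1}\alpha_0+F_k\alpha_1$ (called $\alpha$-type) and $F_k\alpha_0+F_{k+1}\alpha_1$ (called $\beta$-type), $k\ge0$. A root vector is called of $\alpha$-type or $\beta$-type according to its root. *)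

(* Defs.v *)
From HB Require Import structures.
From mathcomp Require Import all_boot all_order all_algebra generic_quotient.
From mathcomp Require Import boolp classical_sets reals.
From mathcomp Require Import complex.

Set Implicit Arguments.
Unset Strict Implicit.
Unset Printing Implicit Defensive.

Import Order.TTheory GRing.Theory Num.Theory.
Local Open Scope ring_scope.
Local Open Scope quotient_scope.

(* Construction of the Kac-Moody algebra g(A) = g~(A) / r, following Kac.
   The base field K is instantiated with the complex numbers.  The matrix A is
   meant to be nonsingular, so that the Cartan subalgebra is spanned by the
   h_i and the simple roots form a basis of its dual. *)

Inductive lterm (K : Type) (n : nat) : Type :=
| Te of 'I_n
| Tf of 'I_n
| Th of 'I_n
| Tzero
| Tadd of lterm K n & lterm K n
| Tscale of K & lterm K n
| Tbr of lterm K n & lterm K n.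

Arguments Te {K n}.
Arguments Tf {K n}.
Arguments Th {K n}.
Arguments Tzero {K n}.
Arguments Tadd {K n}.
Arguments Tscale {K n}.
Arguments Tbr {K n}.

HB.instance Definition _ (K : Type) (n : nat) := gen_eqMixin (lterm K n).
HB.instance Definition _ (K : Type) (n : nat) := gen_choiceMixin (lterm K n).

Section KacMoody.
Variables (K : numClosedFieldType) (n : nat) (A : 'M[int]_n).
Local Notation term := (lterm K n).

(* Equality in g~(A), the Lie algebra presented by the generators e_i, f_i,
   h_i and the last four relations; the other constructors say that it is a
   congruence containing the axioms of Lie algebras over K. *)
Inductive tilde_eq : term -> term -> Prop :=
| tilde_refl t : tilde_eq t t
| tilde_sym t u : tilde_eq t u -> tilde_eq u t
| tilde_trans t u v : tilde_eq t u -> tilde_eq u v -> tilde_eq t v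
| tilde_congD t t' u u' :
    tilde_eq t t' -> tilde_eq u u' -> tilde_eq (Tadd t u) (Tadd t' u')
| tilde_congZ c t t' : tilde_eq t t' -> tilde_eq (Tscale c t) (Tscale c t')
| tilde_congB t t' u u' :
    tilde_eq t t' -> tilde_eq u u' -> tilde_eq (Tbr t u) (Tbr t' u')
| tilde_addA t u v : tilde_eq (Tadd t (Tadd u v)) (Tadd (Tadd t u) v)
| tilde_addC t u : tilde_eq (Tadd t u) (Tadd u t)
| tilde_add0 t : tilde_eq (Tadd Tzero t) t
| tilde_addN t : tilde_eq (Tadd (Tscale (-1) t) t) Tzero
| tilde_scaleA c d t : tilde_eq (Tscale c (Tscale d t)) (Tscale (c * d) t)
| tilde_scale1 t : tilde_eq (Tscale 1 t) t
| tilde_scaleDr c t u :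
    tilde_eq (Tscale c (Tadd t u)) (Tadd (Tscale c t) (Tscale c u))
| tilde_scaleDl c d t :
    tilde_eq (Tscale (c + d) t) (Tadd (Tscale c t) (Tscale d t))
| tilde_brDl t u v : tilde_eq (Tbr (Tadd t u) v) (Tadd (Tbr t v) (Tbr u v))
| tilde_brDr t u v : tilde_eq (Tbr t (Tadd u v)) (Tadd (Tbr t u) (Tbr t v))
| tilde_brZl c t u : tilde_eq (Tbr (Tscale c t) u) (Tscale c (Tbr t u))
| tilde_brZr c t u : tilde_eq (Tbr t (Tscale c u)) (Tscale c (Tbr t u))
| tilde_br_alt t : tilde_eq (Tbr t t) Tzero
| tilde_jacobi t u v :
    tilde_eq (Tadd (Tbr t (Tbr u v)) (Tadd (Tbr u (Tbr v t)) (Tbr v (Tbr t u))))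
      Tzero
| tilde_hh i j : tilde_eq (Tbr (Th i) (Th j)) Tzero
| tilde_ef i j :
    tilde_eq (Tbr (Te i) (Tf j)) (if i == j then Th i else Tzero)
| tilde_he i j : tilde_eq (Tbr (Th i) (Te j)) (Tscale (A i j)%:~R (Te j))
| tilde_hf i j : tilde_eq (Tbr (Th i) (Tf j)) (Tscale (- (A i j)%:~R) (Tf j)).

(* Ideals of g~(A), as predicates on terms.  Closure under the bracket on one
   side suffices, by antisymmetry. *)
Record tilde_ideal (I : term -> Prop) : Prop := TildeIdeal {
  ideal_eq : forall t u, tilde_eq t u -> I t -> I u;
  ideal_0 : I Tzero;
  ideal_D : forall t u, I t -> I u -> I (Tadd t u);
  ideal_Z : forall c t, I t -> I (Tscale c t);
  ideal_br : forall t u, I u -> I (Tbr t u) }.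

Definition hterm (c : 'I_n -> K) : term :=
  foldr (fun i t => Tadd (Tscale (c i) (Th i)) t) Tzero (enum 'I_n).

Definition meets_h_trivially (I : term -> Prop) : Prop :=
  forall c : 'I_n -> K, I (hterm c) -> tilde_eq (hterm c) Tzero.

(* The sum of all the ideals of g~(A) that meet the Cartan subalgebra
   trivially, i.e. the largest such ideal. *)
Definition radical (t : term) : Prop :=
  forall J, tilde_ideal J ->
    (forall I, tilde_ideal I -> meets_h_trivially I ->
       forall u, I u -> J u) ->
    J t.

Lemma radical_ideal : tilde_ideal radical.
Proof.
split=> [t u tu rt|J iJ _|t u rt ru|c t rt|t u ru] /=.
- by move=> J iJ sJ; apply: (ideal_eq iJ tu); apply: rt.
- exact: ideal_0 iJ.
- by move=> J iJ sJ; apply: (ideal_D iJ); [apply: rt|apply: ru].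
- by move=> J iJ sJ; apply: (ideal_Z iJ); apply: rt.
- by move=> J iJ sJ; apply: (ideal_br iJ); apply: ru.
Qed.

Definition km_rel (t u : term) : Prop := radical (Tadd t (Tscale (-1) u)).

Lemma tilde_scale0 t : tilde_eq (Tscale 0 t) Tzero.
Proof.
apply: tilde_trans (tilde_addN t).
rewrite -[X in Tscale X t](addNr 1).
apply: tilde_trans (tilde_scaleDl _ _ _) _.
by apply: tilde_congD; [exact: tilde_refl|exact: tilde_scale1].
Qed.

Lemma tilde_subKr t u :
  tilde_eq (Tadd (Tadd t (Tscale (-1) u)) u) t.
Proof.
apply: tilde_trans (tilde_sym (tilde_addA _ _ _)) _.
apply: tilde_trans (tilde_congD (tilde_refl t) (tilde_addN u)) _.
by apply: tilde_trans (tilde_addC _ _) _; apply: tilde_add0.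
Qed.

Lemma km_rel_tilde t u : tilde_eq t u -> km_rel t u.
Proof.
move=> tu; apply: (ideal_eq radical_ideal) (ideal_0 radical_ideal).
apply: tilde_sym.
apply: tilde_trans (tilde_congD tu (tilde_refl _)) _.
by apply: tilde_trans (tilde_addC _ _) _; apply: tilde_addN.
Qed.

Lemma km_rel_sub (I : term -> Prop) t u : tilde_ideal I ->
  I (Tadd t (Tscale (-1) u)) -> I u -> I t.
Proof.
move=> iI Itu Iu; apply: (ideal_eq iI (tilde_subKr t u)).
exact: ideal_D.
Qed.

Lemma tilde_opp_sub t u :
  tilde_eq (Tscale (-1) (Tadd t (Tscale (-1) u))) (Tadd u (Tscale (-1) t)).
Proof.
apply: tilde_trans (tilde_scaleDr _ _ _) _.
apply: tilde_trans (tilde_addC _ _) _; apply: tilde_congD (tilde_refl _).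
apply: tilde_trans (tilde_scaleA _ _ _) _; rewrite mulrNN mulr1.
exact: tilde_scale1.
Qed.

Lemma tilde_add_sub t u t' u' :
  tilde_eq (Tadd (Tadd t (Tscale (-1) t')) (Tadd u (Tscale (-1) u')))
    (Tadd (Tadd t u) (Tscale (-1) (Tadd t' u'))).
Proof.
apply: (@tilde_trans _
  (Tadd (Tadd t u) (Tadd (Tscale (-1) t') (Tscale (-1) u')))); last first.
  by apply: tilde_congD (tilde_refl _) _; apply/tilde_sym/tilde_scaleDr.
apply: tilde_trans (tilde_sym (tilde_addA _ _ _)) _.
apply: tilde_trans (tilde_addA _ _ _).
apply: tilde_congD (tilde_refl _) _.
apply: tilde_trans (tilde_addA _ _ _) _.
apply: tilde_trans (tilde_congD (tilde_addC _ _) (tilde_refl _)) _.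
exact: tilde_sym (tilde_addA _ _ _).
Qed.

Lemma km_rel_refl t : km_rel t t.
Proof. by apply: km_rel_tilde; apply: tilde_refl. Qed.

Lemma km_rel_sym t u : km_rel t u -> km_rel u t.
Proof.
move=> tu; apply: (ideal_eq radical_ideal (tilde_opp_sub t u)).
exact: (ideal_Z radical_ideal).
Qed.

Lemma km_relD t t' u u' :
  km_rel t t' -> km_rel u u' -> km_rel (Tadd t u) (Tadd t' u').
Proof.
move=> tt' uu'; apply: (ideal_eq radical_ideal (tilde_add_sub _ _ _ _)).
exact: (ideal_D radical_ideal).
Qed.

Lemma km_rel_trans t u v : km_rel t u -> km_rel u v -> km_rel t v.
Proof.
move=> tu uv.
have := ideal_D radical_ideal tu uv; apply: (ideal_eq radical_ideal).
apply: tilde_trans (tilde_addA _ _ _) _.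
exact: tilde_congD (tilde_subKr _ _) (tilde_refl _).
Qed.

Lemma km_relZ c t t' : km_rel t t' -> km_rel (Tscale c t) (Tscale c t').
Proof.
move=> /(ideal_Z radical_ideal c); apply: (ideal_eq radical_ideal).
apply: tilde_trans (tilde_scaleDr _ _ _) _.
apply: tilde_congD (tilde_refl _) _.
apply: tilde_trans (tilde_scaleA _ _ _) _; rewrite mulrC.
exact: tilde_sym (tilde_scaleA _ _ _).
Qed.

Lemma km_rel_brr t u u' : km_rel u u' -> km_rel (Tbr t u) (Tbr t u').
Proof.
move=> /(ideal_br radical_ideal t); apply: (ideal_eq radical_ideal).
apply: tilde_trans (tilde_brDr _ _ _) _.
exact: tilde_congD (tilde_refl _) (tilde_brZr _ _ _).
Qed.

Lemma tilde_brC t u : tilde_eq (Tbr t u) (Tscale (-1) (Tbr u t)).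
Proof.
have e0 : tilde_eq (Tadd (Tbr t u) (Tbr u t)) Tzero.
  apply: tilde_trans (tilde_br_alt (Tadd t u)); apply: tilde_sym.
  apply: tilde_trans (tilde_brDl _ _ _) _.
  apply: tilde_trans (tilde_congD (tilde_brDr _ _ _) (tilde_brDr _ _ _)) _.
  apply: tilde_congD.
    apply: tilde_trans (tilde_congD (tilde_br_alt _) (tilde_refl _)) _.
    exact: tilde_add0.
  apply: tilde_trans (tilde_congD (tilde_refl _) (tilde_br_alt _)) _.
  by apply: tilde_trans (tilde_addC _ _) _; apply: tilde_add0.
apply: tilde_trans (tilde_sym (tilde_subKr _ (Tbr u t))) _.
apply: tilde_trans (tilde_sym (tilde_addA _ _ _)) _.
apply: tilde_trans (tilde_congD (tilde_refl _) (tilde_addC _ _)) _.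
apply: tilde_trans (tilde_addA _ _ _) _.
apply: tilde_trans (tilde_congD e0 (tilde_refl _)) _.
exact: tilde_add0.
Qed.

Lemma km_relB t t' u u' :
  km_rel t t' -> km_rel u u' -> km_rel (Tbr t u) (Tbr t' u').
Proof.
move=> tt' uu'; apply: km_rel_trans (km_rel_brr t uu') _.
apply: km_rel_trans (km_rel_tilde (tilde_brC _ _)) _.
apply: km_rel_trans (km_rel_tilde (tilde_sym (tilde_brC _ _))).
by apply: km_relZ; apply: km_rel_brr.
Qed.

Definition km_relb : rel term := [rel t u | `[< km_rel t u >]].

Lemma km_relb_refl : reflexive km_relb.
Proof. by move=> t; apply/asboolP; exact: km_rel_refl. Qed.

Lemma km_relb_sym : symmetric km_relb.
Proof. by move=> t u; apply/asboolP/asboolP => h; apply: km_rel_sym h. Qed.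

Lemma km_relb_trans : transitive km_relb.
Proof.
by move=> u t v /asboolP tu /asboolP uv; apply/asboolP; apply: km_rel_trans tu uv.
Qed.

Definition km_equiv : equiv_rel term :=
  EquivRel km_relb km_relb_refl km_relb_sym km_relb_trans.

Definition km : Type := {eq_quot km_equiv}.
HB.instance Definition _ := Choice.on km.
HB.instance Definition _ := EqQuotient.on km.

Lemma km_piP t u : \pi_km t = \pi_km u <-> km_rel t u.
Proof.
split=> [/eqP|tu]; last by apply/eqP; rewrite piE; apply/asboolP.
by rewrite piE => /asboolP.
Qed.

Lemma km_reprK t : km_rel (repr (\pi_km t)) t.
Proof. by apply/km_piP; rewrite reprK. Qed.

Definition km_e (i : 'I_n) : km := \pi_km (Te i).
Definition km_f (i : 'I_n) : km := \pi_km (Tf i).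
Definition km_h (i : 'I_n) : km := \pi_km (Th i).
Definition km_zero : km := \pi_km Tzero.
Definition km_add : km -> km -> km := lift_op2 km Tadd.
Definition km_scale (c : K) : km -> km := lift_op1 km (Tscale c).
Definition km_opp (x : km) : km := km_scale (-1) x.
Definition lie : km -> km -> km := lift_op2 km Tbr.

Lemma km_pi_add t u : km_add (\pi_km t) (\pi_km u) = \pi_km (Tadd t u).
Proof. by rewrite /km_add -lock; apply/km_piP; apply: km_relD; apply: km_reprK. Qed.

Lemma km_pi_scale c t : km_scale c (\pi_km t) = \pi_km (Tscale c t).
Proof. by rewrite /km_scale -lock; apply/km_piP; apply: km_relZ; apply: km_reprK. Qed.

Lemma km_pi_lie t u : lie (\pi_km t) (\pi_km u) = \pi_km (Tbr t u).
Proof. by rewrite /lie -lock; apply/km_piP; apply: km_relB; apply: km_reprK. Qed.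

Lemma km_pi_eq t u : tilde_eq t u -> \pi_km t = \pi_km u.
Proof. by move=> tu; apply/km_piP; apply: km_rel_tilde. Qed.

Lemma km_addA : associative km_add.
Proof.
elim/quotP=> t _; elim/quotP=> u _; elim/quotP=> v _.
by rewrite !km_pi_add; apply: km_pi_eq; apply: tilde_addA.
Qed.

Lemma km_addC : commutative km_add.
Proof.
elim/quotP=> t _; elim/quotP=> u _.
by rewrite !km_pi_add; apply: km_pi_eq; apply: tilde_addC.
Qed.

Lemma km_add0 : left_id km_zero km_add.
Proof. by elim/quotP=> t _; rewrite km_pi_add; apply: km_pi_eq; apply: tilde_add0. Qed.

Lemma km_addN : left_inverse km_zero km_opp km_add.
Proof.
elim/quotP=> t _; rewrite /km_opp km_pi_scale km_pi_add.
by apply: km_pi_eq; apply: tilde_addN.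
Qed.

HB.instance Definition _ :=
  GRing.isZmodule.Build km km_addA km_addC km_add0 km_addN.

Lemma km_scaleA c d x : km_scale c (km_scale d x) = km_scale (c * d) x.
Proof.
by elim/quotP: x => t _; rewrite !km_pi_scale; apply: km_pi_eq; apply: tilde_scaleA.
Qed.

Lemma km_scale1 : left_id 1 km_scale.
Proof.
by elim/quotP=> t _; rewrite km_pi_scale; apply: km_pi_eq; apply: tilde_scale1.
Qed.

Lemma km_scaleDr : right_distributive km_scale +%R.
Proof.
move=> c; elim/quotP=> t _; elim/quotP=> u _.
rewrite /GRing.add /= !(km_pi_scale, km_pi_add).
by apply: km_pi_eq; apply: tilde_scaleDr.
Qed.

Lemma km_scaleDl x : {morph km_scale^~ x : c d / c + d}.
Proof.
elim/quotP: x => t _ c d; rewrite [RHS]/GRing.add /= !(km_pi_scale, km_pi_add).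
by apply: km_pi_eq; apply: tilde_scaleDl.
Qed.

HB.instance Definition _ :=
  GRing.Zmodule_isLmodule.Build K km km_scaleA km_scale1 km_scaleDr km_scaleDl.

Lemma pi_kmD t u : \pi_km (Tadd t u) = \pi_km t + \pi_km u.
Proof. by rewrite -km_pi_add. Qed.

Lemma pi_kmZ c t : \pi_km (Tscale c t) = c *: \pi_km t.
Proof. by rewrite -km_pi_scale. Qed.

Lemma pi_kmB t u : \pi_km (Tbr t u) = lie (\pi_km t) (\pi_km u).
Proof. by rewrite km_pi_lie. Qed.

Lemma pi_km0 : \pi_km Tzero = 0.
Proof. by []. Qed.

Lemma lieDl x y z : lie (x + y) z = lie x z + lie y z.
Proof.
elim/quotP: x => t _; elim/quotP: y => u _; elim/quotP: z => v _.
by rewrite -!(pi_kmD, pi_kmB); apply: km_pi_eq; apply: tilde_brDl.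
Qed.

Lemma lieDr x y z : lie x (y + z) = lie x y + lie x z.
Proof.
elim/quotP: x => t _; elim/quotP: y => u _; elim/quotP: z => v _.
by rewrite -!(pi_kmD, pi_kmB); apply: km_pi_eq; apply: tilde_brDr.
Qed.

Lemma lieZl c x y : lie (c *: x) y = c *: lie x y.
Proof.
elim/quotP: x => t _; elim/quotP: y => u _.
by rewrite -!(pi_kmZ, pi_kmB); apply: km_pi_eq; apply: tilde_brZl.
Qed.

Lemma lieZr c x y : lie x (c *: y) = c *: lie x y.
Proof.
elim/quotP: x => t _; elim/quotP: y => u _.
by rewrite -!(pi_kmZ, pi_kmB); apply: km_pi_eq; apply: tilde_brZr.
Qed.

Lemma liexx x : lie x x = 0.
Proof. by elim/quotP: x => t _; rewrite -pi_kmB; apply: km_pi_eq; apply: tilde_br_alt. Qed.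

Lemma lie_jacobi x y z :
  lie x (lie y z) + (lie y (lie z x) + lie z (lie x y)) = 0.
Proof.
elim/quotP: x => t _; elim/quotP: y => u _; elim/quotP: z => v _.
by rewrite -!(pi_kmD, pi_kmB); apply: km_pi_eq; apply: tilde_jacobi.
Qed.

Lemma lie_hh i j : lie (km_h i) (km_h j) = 0.
Proof. by rewrite -pi_kmB; apply: km_pi_eq; apply: tilde_hh. Qed.

Lemma lie_ef i j : lie (km_e i) (km_f j) = if i == j then km_h i else 0.
Proof.
rewrite -pi_kmB (km_pi_eq (tilde_ef i j)).
by case: eqP.
Qed.

Lemma lie_he i j : lie (km_h i) (km_e j) = (A i j)%:~R *: km_e j.
Proof. by rewrite -pi_kmB -pi_kmZ; apply: km_pi_eq; apply: tilde_he. Qed.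

Lemma lie_hf i j : lie (km_h i) (km_f j) = - (A i j)%:~R *: km_f j.
Proof. by rewrite -pi_kmB -pi_kmZ; apply: km_pi_eq; apply: tilde_hf. Qed.

Definition lie_subalgebra : set (set km) := [set B : set km |
  [/\ B 0, (forall (c : K) (x y : km), B x -> B y -> B (c *: x + y))
     & (forall x y : km, B x -> B y -> B (lie x y))]].

Definition cartan : set km :=
  [set x | exists c : 'I_n -> K, x = \sum_(i < n) c i *: km_h i].
Definition nplus : set km := smallest lie_subalgebra (range km_e).
Definition nminus : set km := smallest lie_subalgebra (range km_f).

(* Roots.  Every root is an integral combination of the simple roots; the row
   vector g stands for the linear form \sum_j g_j alpha_j. *)

Definition simple_root (j : 'I_n) : 'rV[int]_n := delta_mx 0 j.

Definition pairing (i : 'I_n) (g : 'rV[int]_n) : int := \sum_j A i j * g 0 j.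

Definition root_space (g : 'rV[int]_n) : set km :=
  [set x | forall c : 'I_n -> K,
     lie (\sum_(i < n) c i *: km_h i) x =
     (\sum_(i < n) c i * (pairing i g)%:~R) *: x].

Definition is_root (g : 'rV[int]_n) : Prop :=
  g != 0 /\ exists x : km, x != 0 /\ root_space g x.

Definition reflection (i : 'I_n) (g : 'rV[int]_n) : 'rV[int]_n :=
  g - pairing i g *: simple_root i.

Definition real_root (g : 'rV[int]_n) : Prop :=
  is_root g /\
  exists (w : seq 'I_n) (j : 'I_n), g = foldr reflection (simple_root j) w.

Definition positive_root (g : 'rV[int]_n) : Prop :=
  is_root g /\ forall j, 0 <= g 0 j.

Definition real_positive_vector_of (g : 'rV[int]_n) (x : km) : Prop :=
  [/\ real_root g, positive_root g, x != 0 & root_space g x].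

Definition real_positive_vector (x : km) : Prop :=
  exists g, real_positive_vector_of g x.

Definition real_positive_span : set km :=
  [set x | exists (m : nat) (c : 'I_m -> K) (E : 'I_m -> km),
     (forall i, real_positive_vector (E i)) /\ x = \sum_(i < m) c i *: E i].

Definition has_length (x : km) (m : nat) : Prop :=
  exists (b : 'I_m -> 'rV[int]_n) (c : 'I_m -> K) (E : 'I_m -> km),
    [/\ injective b,
        forall i, real_root (b i),
        forall i, c i != 0,
        forall i, E i != 0 /\ root_space (b i) (E i)
      & x = \sum_(i < m) c i *: E i].

Definition sl2_triple (x y h : km) : Prop :=
  [/\ [/\ x != 0, y != 0 & h != 0],
      [/\ nplus x, nminus y & cartan h]
    & [/\ lie h x = 2 *: x, lie h y = - 2 *: y & lie x y = h]].

Record compact_involution (omega : km -> km) : Prop := CompactInvolution {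
  omega_bij : bijective omega;
  omega_D : forall x y, omega (x + y) = omega x + omega y;
  omega_Z : forall (c : K) x, omega (c *: x) = c^* *: omega x;
  omega_lie : forall x y, omega (lie x y) = lie (omega x) (omega y);
  omega_e : forall i, omega (km_e i) = - km_f i;
  omega_f : forall i, omega (km_f i) = - km_e i;
  omega_hR : forall r : 'I_n -> K, (forall i, r i \is Num.real) ->
    omega (\sum_(i < n) r i *: km_h i) = - \sum_(i < n) r i *: km_h i }.

End KacMoody.

Section CompactInvolution.
Variables (K : numClosedFieldType) (n : nat) (A : 'M[int]_n).
Local Notation term := (lterm K n).
Local Notation teq := (@tilde_eq K n A).

Fixpoint omega_term (t : term) : term :=
  match t with
  | Te i => Tscale (-1) (Tf i)
  | Tf i => Tscale (-1) (Te i)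
  | Th i => Tscale (-1) (Th i)
  | Tzero => Tzero
  | Tadd t u => Tadd (omega_term t) (omega_term u)
  | Tscale c t => Tscale c^* (omega_term t)
  | Tbr t u => Tbr (omega_term t) (omega_term u)
  end.

Lemma tilde_brNN t u :
  teq (Tbr (Tscale (-1) t) (Tscale (-1) u)) (Tbr t u).
Proof.
apply: tilde_trans (tilde_brZl _ _ _ _) _.
apply: tilde_trans (tilde_congZ _ (tilde_brZr _ _ _ _)) _.
apply: tilde_trans (tilde_scaleA _ _ _ _) _; rewrite mulrNN mulr1.
exact: tilde_scale1.
Qed.

Lemma tilde_scaleC c d t : teq (Tscale c (Tscale d t)) (Tscale d (Tscale c t)).
Proof.
apply: tilde_trans (tilde_scaleA _ _ _ _) _; rewrite mulrC.
exact: tilde_sym (tilde_scaleA _ _ _ _).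
Qed.

Lemma tilde_scaler0 c : teq (Tscale c Tzero) Tzero.
Proof.
apply: tilde_trans (tilde_congZ c (tilde_sym (tilde_scale0 _ Tzero))) _.
apply: tilde_trans (tilde_scaleA _ _ _ _) _; rewrite mulr0.
exact: tilde_scale0.
Qed.

Lemma omega_term_eq t u : teq t u -> teq (omega_term t) (omega_term u).
Proof.
elim=> /=; try by move=> *; constructor.
- by move=> {}t {}u v _ tu _ uv; apply: tilde_trans tu uv.
- by move=> {}t; rewrite rmorphN rmorph1; apply: tilde_addN.
- by move=> c d {}t; rewrite rmorphM; apply: tilde_scaleA.
- by move=> {}t; rewrite rmorph1; apply: tilde_scale1.
- by move=> c d {}t; rewrite rmorphD; apply: tilde_scaleDl.
- by move=> i j; apply: tilde_trans (tilde_brNN _ _) _; apply: tilde_hh.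
- move=> i j; apply: tilde_trans (tilde_brNN _ _) _.
  apply: tilde_trans (tilde_brC _ _ _) _.
  apply: tilde_trans (tilde_congZ (-1) (tilde_ef K A j i)) _.
  rewrite eq_sym.
  by case: eqP => [->|_] /=; [exact: tilde_refl|exact: tilde_scaler0].
- move=> i j; apply: tilde_trans (tilde_brNN _ _) _.
  apply: tilde_trans (tilde_hf K A i j) _; rewrite rmorph_int.
  by apply: tilde_trans _ (tilde_sym (tilde_scaleA _ _ _ _)); rewrite mulrN1;
    apply: tilde_refl.
- move=> i j; apply: tilde_trans (tilde_brNN _ _) _.
  apply: tilde_trans (tilde_he K A i j) _; rewrite rmorphN rmorph_int.
  by apply: tilde_trans _ (tilde_sym (tilde_scaleA _ _ _ _));
    rewrite mulrN1 opprK; apply: tilde_refl.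
Qed.

Lemma omega_termK t : teq (omega_term (omega_term t)) t.
Proof.
elim: t => [i|i|i||t IHt u IHu|c t IHt|t IHt u IHu] /=.
1-3: rewrite rmorphN rmorph1; apply: tilde_trans (tilde_scaleA _ _ _ _) _;
  by rewrite mulrNN mulr1; apply: tilde_scale1.
- exact: tilde_refl.
- exact: tilde_congD.
- by rewrite conjCK; apply: tilde_congZ.
- exact: tilde_congB.
Qed.

Definition omega_pre (I : term -> Prop) : term -> Prop :=
  fun t => I (omega_term t).

Lemma omega_pre_ideal I : tilde_ideal A I -> tilde_ideal A (omega_pre I).
Proof.
move=> iI; split=> [t u tu||t u|c t|t u]; rewrite /omega_pre /=.
- by apply: (ideal_eq iI); apply: omega_term_eq.
- exact: ideal_0 iI.
- exact: (ideal_D iI).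
- exact: (ideal_Z iI).
- exact: (ideal_br iI).
Qed.

Lemma omega_hterm (c : 'I_n -> K) :
  teq (omega_term (hterm c)) (Tscale (-1) (hterm (fun i => (c i)^*))).
Proof.
rewrite /hterm; elim: (enum _) => [|i s IHs] /=.
  exact: tilde_sym (tilde_scaler0 _).
apply: tilde_trans _ (tilde_sym (tilde_scaleDr _ _ _ _)).
exact: tilde_congD (tilde_scaleC _ _ _) IHs.
Qed.

Lemma omega_pre_trivial I : tilde_ideal A I ->
  meets_h_trivially A I -> meets_h_trivially A (omega_pre I).
Proof.
move=> iI hI c Ic.
have Nn t : teq (Tscale (-1) (Tscale (-1) t)) t.
  apply: tilde_trans (tilde_scaleA _ _ _ _) _; rewrite mulrNN mulr1.
  exact: tilde_scale1.
have /hI h0 : I (hterm (fun i => (c i)^*)).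
  apply: (ideal_eq iI (Nn _)); apply: (ideal_Z iI).
  exact: (ideal_eq iI (omega_hterm c)).
apply: tilde_trans (tilde_sym (omega_termK _)) _.
have -> : Tzero = omega_term Tzero by [].
apply: omega_term_eq; apply: tilde_trans (omega_hterm c) _.
by apply: tilde_trans (tilde_congZ _ h0) _; apply: tilde_scaler0.
Qed.

Lemma omega_radical t : radical A t -> radical A (omega_term t).
Proof.
move=> rt J iJ sJ; apply: (rt _ (omega_pre_ideal iJ)) => I iI hI u Iu.
apply: (sJ _ (omega_pre_ideal iI) (omega_pre_trivial iI hI)).
exact: (ideal_eq iI (tilde_sym (omega_termK u))).
Qed.

Definition km_omega : km K A -> km K A := lift_op1 (km K A) omega_term.

Lemma km_pi_omega t : km_omega (\pi t) = \pi_(km K A) (omega_term t).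
Proof.
rewrite /km_omega -lock; apply/km_piP.
have /omega_radical := @km_reprK _ _ A t.
by rewrite /= rmorphN rmorph1.
Qed.

Lemma km_omega_involution : compact_involution km_omega.
Proof.
have oD x y : km_omega (x + y) = km_omega x + km_omega y.
  elim/quotP: x => t _; elim/quotP: y => u _.
  by rewrite -pi_kmD !km_pi_omega pi_kmD.
have oZ c x : km_omega (c *: x) = c^* *: km_omega x.
  by elim/quotP: x => t _; rewrite -pi_kmZ !km_pi_omega pi_kmZ.
have oh i : km_omega (km_h K A i) = - km_h K A i.
  by rewrite km_pi_omega pi_kmZ scaleN1r.
split=> [|//|//|x y|i|i|r rR].
- have oK : involutive km_omega.
    elim/quotP=> t _; rewrite !km_pi_omega.
    by apply: km_pi_eq; apply: omega_termK.
  by exists km_omega.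
- elim/quotP: x => t _; elim/quotP: y => u _.
  by rewrite -pi_kmB !km_pi_omega pi_kmB.
- by rewrite km_pi_omega pi_kmZ scaleN1r.
- by rewrite km_pi_omega pi_kmZ scaleN1r.
- rewrite (big_morph km_omega oD (id1 := 0)); last first.
    by rewrite -[0](scale0r 0) oZ rmorph0 !scale0r.
  rewrite -sumrN; apply: eq_bigr => i _.
  by rewrite oZ oh scalerN (conj_Creal (rR i)).
Qed.

End CompactInvolution.

Definition cartan2 (a : int) : 'M[int]_2 :=
  \matrix_(i, j) (if i == j then 2 else - a).

(* The pair (F_k, F_{k+1}). *)
Fixpoint Fpair (a : int) (k : nat) : int * int :=
  if k is k'.+1 then
    let: (u, v) := Fpair a k' in (v, a * v - u)
  else (0, 1).

Definition Fseq (a : int) (k : nat) : int := (Fpair a k).1.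

Lemma FseqE (a : int) : [/\ Fseq a 0 = 0, Fseq a 1 = 1 &
  forall k, Fseq a k.+2 = a * Fseq a k.+1 - Fseq a k].
Proof. by split=> // k; rewrite /Fseq /=; case: (Fpair a k). Qed.

Definition alpha_root (a : int) (g : 'rV[int]_2) : Prop :=
  exists k, g = Fseq a k.+1 *: simple_root 0 + Fseq a k *: simple_root 1.

Definition beta_root (a : int) (g : 'rV[int]_2) : Prop :=
  exists k, g = Fseq a k *: simple_root 0 + Fseq a k.+1 *: simple_root 1.

Definition alpha_type (K : numClosedFieldType) (a : int)
    (x : km K (cartan2 a)) : Prop :=
  exists g, real_positive_vector_of g x /\ alpha_root a g.

Definition beta_type (K : numClosedFieldType) (a : int)
    (x : km K (cartan2 a)) : Prop :=
  exists g, real_positive_vector_of g x /\ beta_root a g.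

(* Main.v *)
Require Import Defs.
From HB Require Import structures.
From mathcomp Require Import all_boot all_order all_algebra generic_quotient.
From mathcomp Require Import boolp classical_sets reals.
From mathcomp Require Import complex ring zify.

Set Implicit Arguments.
Unset Strict Implicit.
Unset Printing Implicit Defensive.

Import Order.TTheory GRing.Theory Num.Theory.
Local Open Scope ring_scope.

(* Every x <> 0 in a real root space g_beta satisfies [x, omega x] = -p beta^vee
   with p > 0.  For beta simple this is omega(e_j) = -f_j.  The general case
   follows by applying exp((pi/2) ad u), u = e_i - f_i, which acts on the weights
   as the simple reflection s_i and commutes with omega because omega fixes u.
   That ad u is diagonalizable with eigenvalues in iZ rests on the Serre
   relations, which hold in the quotient because the Serre elements generate
   ideals lying in the positive part of g~.

   If X = sum_i c_i E_i gives a triple, then beta_i(H) = 2 for all i, so the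
   beta_i lie on a line and on the conic (beta, beta) = 2: there are at most two
   of them.  If there is only one, H = -p beta^vee has beta(H) = -2p < 0.
   For roots beta_0, beta_1 of different types m = -(beta_0, beta_1) >= 3, so
   beta_0 - beta_1 has norm 4 + 2m > 2 and is not a weight of g; the cross terms
   of [X, omega X] then vanish, and scaling so that H = -q (beta_0 + beta_1)^vee
   with q = 2 / (m - 2) gives a triple. *)

(** * Separation of joint eigenvectors; linear spans *)

Section Eigenvectors.
Variables (K : fieldType) (V : lmodType K).

(** Induction on [s]: applying [D i - mu t i] for an index [i] that separates the head [t] kills
    [z t] and multiplies both [x] and [y] by the nonzero scalar [mu0 i - mu t i]. Since [T] carries
    no decidable equality, the separation hypothesis runs over positions in [s]. *)
Lemma eigen_sep (I T : Type) (D : I -> V -> V)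
    (D_add : forall i x y, D i (x + y) = D i x + D i y)
    (D_scale : forall i c x, D i (c *: x) = c *: D i x)
    (mu : T -> I -> K) (mu0 : I -> K) (z : T -> V) (x y : V) (s : seq T) :
  (forall i, D i x = mu0 i *: x) -> (forall i, D i y = mu0 i *: y) ->
  (forall t i, D i (z t) = mu t i *: z t) ->
  (forall j, (j < size s)%N -> forall t0, exists i, mu (nth t0 s j) i != mu0 i) ->
  x = y + \sum_(t <- s) z t -> x = y.
Proof.
have D0 i : D i 0 = 0 by rewrite -[0](scale0r 0) D_scale !scale0r.
elim: s x y z => [|t s IHs] x y z Dx Dy Dz sep; first by rewrite big_nil addr0.
rewrite big_cons => xE.
have [i mui] := sep 0%N isT t; rewrite /= in mui.
have sep' : forall j, (j < size s)%N -> forall t0, exists i, mu (nth t0 s j) i != mu0 i.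
  by move=> j js; apply: (sep j.+1).
have nz : mu0 i - mu t i != 0 by rewrite subr_eq0 eq_sym.
apply: (scalerI nz).
apply: (IHs _ _ (fun t' => (mu t' i - mu t i) *: z t')) => //.
- by move=> j; rewrite D_scale Dx !scalerA mulrC.
- by move=> j; rewrite D_scale Dy !scalerA mulrC.
- by move=> t' j; rewrite D_scale Dz !scalerA mulrC.
have -> : (mu0 i - mu t i) *: x = D i x - mu t i *: x by rewrite Dx scalerBl.
rewrite {1 2}xE !D_add Dy Dz (big_morph _ (D_add i) (D0 i)).
under eq_bigr do rewrite Dz.
under [in RHS]eq_bigr do rewrite scalerBl.
rewrite sumrB -scaler_sumr !scalerDr [in RHS]scalerBl opprD addrACA; congr (_ + _).
by rewrite opprD addrACA subrr add0r.
Qed.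

Definition lspan (T : Type) (v : T -> V) (x : V) : Prop :=
  exists s : seq (K * T), x = \sum_(m <- s) m.1 *: v m.2.

Variables (T : Type) (v : T -> V).

Lemma lspan_gen t : lspan v (v t).
Proof. by exists [:: (1, t)]; rewrite big_seq1 scale1r. Qed.

Lemma lspan0 : lspan v 0.
Proof. by exists [::]; rewrite big_nil. Qed.

Lemma lspanP c x y : lspan v x -> lspan v y -> lspan v (c *: x + y).
Proof.
move=> [s ->] [s' ->]; exists ([seq (c * m.1, m.2) | m <- s] ++ s').
rewrite big_cat big_map scaler_sumr; congr (_ + _).
by apply: eq_bigr => m _; rewrite scalerA.
Qed.

Lemma lspanZ c x : lspan v x -> lspan v (c *: x).
Proof. by move=> sx; rewrite -[_ *: _]addr0; apply: lspanP lspan0. Qed.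

Lemma lspanD x y : lspan v x -> lspan v y -> lspan v (x + y).
Proof. by rewrite -{2}[x]scale1r; apply: lspanP. Qed.

Lemma lspan_ind (P : V -> Prop) :
  P 0 -> (forall c x y, P x -> P y -> P (c *: x + y)) -> (forall t, P (v t)) ->
  forall x, lspan v x -> P x.
Proof.
move=> P0 PP Pv x [s ->]; elim: s => [|m s IHs]; first by rewrite big_nil.
by rewrite big_cons; apply: PP.
Qed.

End Eigenvectors.

(** * Lie brackets and lowest weight strings *)

Record lie_bracket (K : fieldType) (L : lmodType K) (br : L -> L -> L) : Prop :=
  LieBracket {
  br_Dl : forall x y z, br (x + y) z = br x z + br y z;
  br_Dr : forall x y z, br x (y + z) = br x y + br x z;
  br_Zl : forall c x y, br (c *: x) y = c *: br x y;
  br_Zr : forall c x y, br x (c *: y) = c *: br x y;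
  br_xx : forall x, br x x = 0;
  br_jacobi : forall x y z, br x (br y z) + (br y (br z x) + br z (br x y)) = 0 }.

Section LieTheory.
Variables (K : numClosedFieldType) (L : lmodType K) (br : L -> L -> L).
Hypothesis hL : lie_bracket br.

Lemma br0l x : br 0 x = 0.
Proof. by rewrite -[0](scale0r 0) (br_Zl hL) !scale0r. Qed.

Lemma br0r x : br x 0 = 0.
Proof. by rewrite -[0](scale0r 0) (br_Zr hL) !scale0r. Qed.

Lemma brNl x y : br (- x) y = - br x y.
Proof. by rewrite -scaleN1r (br_Zl hL) scaleN1r. Qed.

Lemma brNr x y : br x (- y) = - br x y.
Proof. by rewrite -scaleN1r (br_Zr hL) scaleN1r. Qed.

Lemma brC x y : br x y = - br y x.
Proof.
apply/eqP; rewrite -subr_eq0 opprK; have := br_xx hL (x + y).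
by rewrite (br_Dl hL) !(br_Dr hL) !(br_xx hL) add0r addr0 => ->.
Qed.

Lemma br_leibniz x y z : br x (br y z) = br (br x y) z + br y (br x z).
Proof.
have /eqP := br_jacobi hL x y z; rewrite addr_eq0 => /eqP ->.
by rewrite [br z x]brC brNr [br z _]brC opprD !opprK addrC.
Qed.

Lemma br_sumr I (s : seq I) (P : pred I) F x :
  br x (\sum_(i <- s | P i) F i) = \sum_(i <- s | P i) br x (F i).
Proof. exact: (big_morph _ (br_Dr hL x) (br0r x)). Qed.

Lemma br_suml I (s : seq I) (P : pred I) F x :
  br (\sum_(i <- s | P i) F i) x = \sum_(i <- s | P i) br (F i) x.
Proof. exact: (big_morph (br^~ x) (fun a b => br_Dl hL a b x) (br0l x)). Qed.

Section LowestWeight.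
Variables (e f h v : L) (N : nat).
Hypotheses (ef : br e f = h) (he : br h e = 2 *: e).
Hypotheses (fv : br f v = 0) (hv : br h v = - N%:R *: v).

Lemma string_h s : br h (iter s (br e) v) = (2 * s%:R - N%:R) *: iter s (br e) v.
Proof.
elim: s => [|s IHs] /=; first by rewrite mulr0 add0r.
rewrite br_leibniz he IHs (br_Zl hL) (br_Zr hL) -scalerDl; congr (_ *: _).
by rewrite -natr1; ring.
Qed.

(** The factor [N - s] vanishes at [s = N]: this makes the Serre elements singular and lets the
    string close up in dimension [N + 1]. *)
Lemma string_f s : br f (iter s.+1 (br e) v) =
  (s.+1%:R * (N%:R - s%:R)) *: iter s (br e) v.
Proof.
have fe : br f e = - h by rewrite brC ef.
elim: s => [|s IHs]; rewrite iterS br_leibniz fe brNl string_h.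
  by rewrite /= fv br0r addr0 -scaleNr; congr (_ *: _); ring.
rewrite IHs (br_Zr hL) -scaleNr -iterS -scalerDl; congr (_ *: _).
by rewrite -!natr1; ring.
Qed.

End LowestWeight.
End LieTheory.

(** Stated for an arbitrary bracket, so that one set of lemmas serves g~(A), its quotient g(A), and
    the same algebras with the roles of [e] and [f] exchanged. *)
Record chevalley (K : numClosedFieldType) (n : nat) (A : 'M[int]_n)
    (L : lmodType K) (br : L -> L -> L) (e f h : 'I_n -> L) : Prop := Chevalley {
  chev_br : lie_bracket br;
  chev_hh : forall i j, br (h i) (h j) = 0;
  chev_ef : forall i j, br (e i) (f j) = if i == j then h i else 0;
  chev_he : forall i j, br (h i) (e j) = (A i j)%:~R *: e j;
  chev_hf : forall i j, br (h i) (f j) = - (A i j)%:~R *: f j }.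

(** * Pairings, weights and monomials in the generators *)

Section Pairing.
Variables (n : nat) (A : 'M[int]_n).

Lemma pairing0 i : pairing A i 0 = 0.
Proof. by rewrite /pairing big1 // => j _; rewrite mxE mulr0. Qed.

Lemma pairingD i g g' : pairing A i (g + g') = pairing A i g + pairing A i g'.
Proof. by rewrite /pairing -big_split; apply: eq_bigr => j _; rewrite mxE mulrDr. Qed.

Lemma pairingZ i c g : pairing A i (c *: g) = c * pairing A i g.
Proof. by rewrite /pairing mulr_sumr; apply: eq_bigr => j _; rewrite mxE mulrCA. Qed.

Lemma pairingN i g : pairing A i (- g) = - pairing A i g.
Proof. by rewrite -scaleN1r pairingZ mulN1r. Qed.

Lemma pairing_simple i j : pairing A i (simple_root j) = A i j.
Proof.
rewrite /pairing (bigD1 j) //= big1 ?addr0 ?mxE ?eqxx ?mulr1 // => k kj.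
by rewrite mxE (negbTE kj) andbF mulr0.
Qed.

End Pairing.

Section Weights.
Variables (K : numClosedFieldType) (n : nat) (A : 'M[int]_n).
Variables (L : lmodType K) (br : L -> L -> L) (e f h : 'I_n -> L).
Hypothesis hc : chevalley A br e f h.
Let hL := chev_br hc.

(** The condition of [root_space], tested on the [h i] only and in any algebra with Chevalley
    generators. *)
Definition weight (g : 'rV[int]_n) (x : L) : Prop :=
  forall i, br (h i) x = (pairing A i g)%:~R *: x.

Lemma weight0 g : weight g 0.
Proof. by move=> i; rewrite (br0r hL) scaler0. Qed.

Lemma weightD g x y : weight g x -> weight g y -> weight g (x + y).
Proof. by move=> wx wy i; rewrite (br_Dr hL) wx wy scalerDr. Qed.

Lemma weightZ g c x : weight g x -> weight g (c *: x).
Proof. by move=> wx i; rewrite (br_Zr hL) wx !scalerA mulrC. Qed.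

Lemma weight_br g g' x y : weight g x -> weight g' y -> weight (g + g') (br x y).
Proof.
move=> wx wy i; rewrite (br_leibniz hL) wx wy (br_Zl hL) (br_Zr hL) -scalerDl.
by rewrite pairingD intrD.
Qed.

Lemma weight_e i : weight (simple_root i) (e i).
Proof. by move=> j; rewrite (chev_he hc) pairing_simple. Qed.

Lemma weight_f i : weight (- simple_root i) (f i).
Proof. by move=> j; rewrite (chev_hf hc) pairingN pairing_simple intrN. Qed.

Lemma weight_h i : weight 0 (h i).
Proof. by move=> j; rewrite (chev_hh hc) pairing0 scale0r. Qed.

Hypothesis A_inj : forall g, (forall i, pairing A i g = 0) -> g = 0.

(** By [A_inj] distinct degrees are separated by some [h i], so [eigen_sep] discards from a
    combination of weight [g] all the terms of other degrees. *)
Lemma lspan_weight_ind (T : Type) (v : T -> L) (deg : T -> 'rV[int]_n) :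
  (forall t, weight (deg t) (v t)) ->
  forall (P : L -> Prop) g, P 0 -> (forall c x y, P x -> P y -> P (c *: x + y)) ->
  (forall t, deg t = g -> P (v t)) ->
  forall x, lspan v x -> weight g x -> P x.
Proof.
move=> wv P g P0 PP Pv x [s xE] wx.
pose y := \sum_(m <- s | deg m.2 == g) m.1 *: v m.2.
have -> : x = y.
  apply: (@eigen_sep _ _ 'I_n (K * T)%type (fun i => br (h i)) _ _
    (fun m i => (pairing A i (deg m.2))%:~R) (fun i => (pairing A i g)%:~R)
    (fun m => m.1 *: v m.2) x y [seq m <- s | deg m.2 != g]) => //.
  - by move=> i ? ?; rewrite (br_Dr hL).
  - by move=> i ? ?; rewrite (br_Zr hL).
  - rewrite /y; apply: (big_ind (weight g)).
    + exact: weight0.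
    + by move=> ? ?; apply: weightD.
    by move=> m /eqP <-; apply: weightZ.
  - by move=> m; apply: weightZ.
  - move=> j js t0.
    have /(all_nthP t0)/(_ _ js) := filter_all (fun m => deg m.2 != g) s.
    set d := nth _ _ _ => dg; apply: contrapT => /forallNP E.
    case/eqP: dg; apply/eqP; rewrite -subr_eq0; apply/eqP.
    apply: A_inj => i; rewrite pairingD pairingN; apply/eqP; rewrite subr_eq0.
    by have /negP := E i; rewrite negbK eqr_int.
  by rewrite big_filter xE (bigID (fun m => deg m.2 == g)).
rewrite /y; elim: s {xE y} => [|m s IHs]; first by rewrite big_nil.
by rewrite big_cons; case: eqP => // /Pv ?; apply: PP.
Qed.

(** Right-normed brackets. The innermost generator is kept apart from the word, so that no monomial
    is empty and every degree is nonzero. *)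
Definition mono (e' : 'I_n -> L) (m : seq 'I_n * 'I_n) : L :=
  foldr (fun k => br (e' k)) (e' m.2) m.1.

Definition deg (m : seq 'I_n * 'I_n) : 'rV[int]_n :=
  \row_k (count_mem k (m.2 :: m.1))%:Z.

Lemma deg_nil i : deg ([::], i) = simple_root i.
Proof. by apply/rowP => k; rewrite !mxE /= addn0 eq_sym; case: eqP. Qed.

Lemma deg_cons k w i : deg (k :: w, i) = simple_root k + deg (w, i).
Proof.
apply/rowP => l; rewrite !mxE /= [l == k]eq_sym addnCA PoszD; congr (_ + _).
by case: eqP.
Qed.

Lemma weight_mono_e m : weight (deg m) (mono e m).
Proof.
case: m => w i; rewrite /mono /=; elim: w => [|k w IHw] /=.
  by rewrite deg_nil; apply: weight_e.
by rewrite deg_cons; apply: weight_br (weight_e _) IHw.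
Qed.

Lemma weight_mono_f m : weight (- deg m) (mono f m).
Proof.
case: m => w i; rewrite /mono /=; elim: w => [|k w IHw] /=.
  by rewrite deg_nil; apply: weight_f.
by rewrite deg_cons opprD; apply: weight_br (weight_f _) IHw.
Qed.

End Weights.

(** * Triangular decomposition and singular monomials *)

Section Triangular.
Variables (K : numClosedFieldType) (n : nat) (A : 'M[int]_n) (L : lmodType K).
Variable br : L -> L -> L.

Definition lie_gen (e f h : 'I_n -> L) : Prop := forall P : L -> Prop,
  P 0 -> (forall c x y, P x -> P y -> P (c *: x + y)) ->
  (forall x y, P x -> P y -> P (br x y)) ->
  (forall i, P (e i)) -> (forall i, P (f i)) -> (forall i, P (h i)) ->
  forall x, P x.

(** The Chevalley involution at the level of generators: results on lowering [e]-monomials also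
    yield those on raising [f]-monomials. *)
Lemma chevalley_swap e f h : chevalley A br e f h ->
  chevalley A br f e (fun i => - h i).
Proof.
move=> hc; have hL := chev_br hc.
split=> // i j; rewrite ?(brNl hL) ?(brNr hL).
- by rewrite (chev_hh hc) !oppr0.
- by rewrite (brC hL) (chev_ef hc) eq_sym; case: eqP => [->|_] //; rewrite oppr0.
- by rewrite (chev_hf hc) scaleNr opprK.
- by rewrite (chev_he hc) scaleNr.
Qed.

Definition borel_val (e h : 'I_n -> L) (t : seq 'I_n * 'I_n + 'I_n) : L :=
  match t with inl m => mono br e m | inr i => h i end.

(** Induction on the word: [f k] passes the outer letter [e l] at the cost of a multiple of [h l],
    which acts on the remaining monomial by a scalar. If the inner bracket leaves some [h j], then
    [[e l, h j]] is a multiple of [e l]. *)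
Lemma lower_mono e f h : chevalley A br e f h ->
  forall k m, lspan (borel_val e h) (br (f k) (mono br e m)).
Proof.
move=> hc k [w i]; have hL := chev_br hc.
have fe l : br (f k) (e l) = - (if l == k then h l else 0).
  by rewrite (brC hL) (chev_ef hc).
elim: w => [|l w IHw].
  rewrite /mono /= fe; case: eqP => _; last by rewrite oppr0; apply: lspan0.
  by rewrite -scaleN1r; apply/lspanZ/(lspan_gen (borel_val e h) (inr i)).
have -> : mono br e (l :: w, i) = br (e l) (mono br e (w, i)) by [].
rewrite (br_leibniz hL) fe; apply: lspanD.
  case: eqP => _; last by rewrite oppr0 (br0l hL); apply: lspan0.
  rewrite (brNl hL) (weight_mono_e hc) -scaleNr.
  exact/lspanZ/(lspan_gen (borel_val e h) (inl (w, i))).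
move: (br (f k) _) IHw; apply: lspan_ind => [|c x y sx sy|[[w' j]|j]].
- by rewrite (br0r hL); apply: lspan0.
- by rewrite (br_Dr hL) (br_Zr hL); apply: lspanP.
- exact: (lspan_gen (borel_val e h) (inl (l :: w', j))).
- rewrite (brC hL) (chev_he hc) -scaleNr.
  exact/lspanZ/(lspan_gen (borel_val e h) (inl ([::], l))).
Qed.

Variables e f h : 'I_n -> L.
Hypothesis hc : chevalley A br e f h.
Let hL := chev_br hc.

Definition tri_val (t : seq 'I_n * 'I_n + seq 'I_n * 'I_n + 'I_n) : L :=
  match t with
  | inl (inl m) => mono br e m
  | inl (inr m) => mono br f m
  | inr i => h i
  end.

Definition tri_deg (t : seq 'I_n * 'I_n + seq 'I_n * 'I_n + 'I_n) :=
  match t with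
  | inl (inl m) => deg m
  | inl (inr m) => - deg m
  | inr i => 0
  end.

Lemma weight_tri t : weight A br h (tri_deg t) (tri_val t).
Proof.
case: t => [[m|m]|i]; [exact: weight_mono_e hc _|exact: weight_mono_f hc _|].
exact: (weight_h hc).
Qed.

(** The span is stable under [ad] of each generator. The elements [y] with [ad y] preserving it form
    a subalgebra by the Jacobi identity, hence everything; the span is then itself a subalgebra
    containing the generators. *)
Lemma span_tri (gen : lie_gen e f h) x : lspan tri_val x.
Proof.
have he k y : lspan tri_val y -> lspan tri_val (br (e k) y).
  move: y; apply: lspan_ind => [|c y z sy sz|[[[w i]|m]|i]].
  - by rewrite (br0r hL); apply: lspan0.
  - by rewrite (br_Dr hL) (br_Zr hL); apply: lspanP.
  - exact: (lspan_gen tri_val (inl (inl (k :: w, i)))).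
  - have := lower_mono (chevalley_swap hc) k m; move: (br _ _).
    apply: lspan_ind => [|c y z|[m'|j]]; [exact: lspan0|exact: lspanP| |].
      exact: (lspan_gen tri_val (inl (inr m'))).
    by rewrite /= -scaleN1r; apply/lspanZ/(lspan_gen tri_val (inr j)).
  - rewrite /= (brC hL) (chev_he hc) -scaleNr.
    exact/lspanZ/(lspan_gen tri_val (inl (inl ([::], k)))).
have hf k y : lspan tri_val y -> lspan tri_val (br (f k) y).
  move: y; apply: lspan_ind => [|c y z sy sz|[[m|[w i]]|i]].
  - by rewrite (br0r hL); apply: lspan0.
  - by rewrite (br_Dr hL) (br_Zr hL); apply: lspanP.
  (* Lowering an [e]-monomial may produce Cartan elements, all of which lie in the span. *)
  - have := lower_mono hc k m; move: (br _ _).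
    apply: lspan_ind => [|c y z|[m'|j]]; [exact: lspan0|exact: lspanP| |].
      exact: (lspan_gen tri_val (inl (inl m'))).
    exact: (lspan_gen tri_val (inr j)).
  - exact: (lspan_gen tri_val (inl (inr (k :: w, i)))).
  - rewrite /= (brC hL) (chev_hf hc) -scaleNr.
    exact/lspanZ/(lspan_gen tri_val (inl (inr ([::], k)))).
have hh k y : lspan tri_val y -> lspan tri_val (br (h k) y).
  move: y; apply: lspan_ind => [|c y z sy sz|t].
  - by rewrite (br0r hL); apply: lspan0.
  - by rewrite (br_Dr hL) (br_Zr hL); apply: lspanP.
  - by rewrite weight_tri; apply/lspanZ/lspan_gen.
have ideal : forall y z, lspan tri_val z -> lspan tri_val (br y z).
  apply: gen => [z _|c y y' hy hy' z sz|y y' hy hy' z sz|||];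
    [| | |exact: he|exact: hf|exact: hh].
  - by rewrite (br0l hL); apply: lspan0.
  - by rewrite (br_Dl hL) (br_Zl hL); apply: lspanP; [apply: hy|apply: hy'].
  - have -> : br (br y y') z = (-1) *: br y' (br y z) + br y (br y' z).
      by rewrite (br_leibniz hL y) addrCA scaleN1r addNr addr0.
    by apply: lspanP; [apply/hy'/hy|apply/hy/hy'].
move: x; apply: gen; [exact: lspan0|exact: lspanP|by move=> *; apply: ideal| | |].
- by move=> i; apply: (lspan_gen tri_val (inl (inl ([::], i)))).
- by move=> i; apply: (lspan_gen tri_val (inl (inr ([::], i)))).
- by move=> i; apply: (lspan_gen tri_val (inr i)).
Qed.

(** A monomial killed by every [f k] generates an ideal in which letters are only ever added
    outside: moving [f k] inwards costs scalars from the [h l], and at the core it gives 0. *)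
Lemma singular_ideal (gen : lie_gen e f h) w0 i0 :
  (forall k, br (f k) (mono br e (w0, i0)) = 0) ->
  forall x y, lspan (fun w => mono br e (w ++ w0, i0)) y ->
    lspan (fun w => mono br e (w ++ w0, i0)) (br x y).
Proof.
move=> sing; set v := fun w => _.
apply: gen => [z _|c y y' hy hy' z sz|y y' hy hy' z sz|k y|k y|k y].
- by rewrite (br0l hL); apply: lspan0.
- by rewrite (br_Dl hL) (br_Zl hL); apply: lspanP; [apply: hy|apply: hy'].
- have -> : br (br y y') z = (-1) *: br y' (br y z) + br y (br y' z).
    by rewrite (br_leibniz hL y) addrCA scaleN1r addNr addr0.
  by apply: lspanP; [apply/hy'/hy|apply/hy/hy'].
- move: y; apply: lspan_ind => [|c y z sy sz|w].
  + by rewrite (br0r hL); apply: lspan0.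
  + by rewrite (br_Dr hL) (br_Zr hL); apply: lspanP.
  + exact: (lspan_gen v (k :: w)).
- move: y; apply: lspan_ind => [|c y z sy sz|w].
  + by rewrite (br0r hL); apply: lspan0.
  + by rewrite (br_Dr hL) (br_Zr hL); apply: lspanP.
  elim: w => [|l w IHw]; first by rewrite /v sing; apply: lspan0.
  have -> : v (l :: w) = br (e l) (v w) by [].
  rewrite (br_leibniz hL) (brC hL (f k)) (chev_ef hc); apply: lspanD.
    case: eqP => _; last by rewrite oppr0 (br0l hL); apply: lspan0.
    by rewrite (brNl hL) (weight_mono_e hc) -scaleNr; apply/lspanZ/lspan_gen.
  move: (br (f k) _) IHw; apply: lspan_ind => [|c y z sy sz|w'].
  + by rewrite (br0r hL); apply: lspan0.
  + by rewrite (br_Dr hL) (br_Zr hL); apply: lspanP.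
  + exact: (lspan_gen v (l :: w')).
- move: y; apply: lspan_ind => [|c y z sy sz|w].
  + by rewrite (br0r hL); apply: lspan0.
  + by rewrite (br_Dr hL) (br_Zr hL); apply: lspanP.
  by rewrite (weight_mono_e hc); apply/lspanZ/lspan_gen.
Qed.

(** For [k = i] this is [string_f] at [s = N]. For [k <> i], [f k] commutes with [e i], so only
    [k = j] matters. There [[e i, h j]] is a multiple of [e i]: a further [e i] kills it if [N > 0],
    and if [N = 0] the multiple is 0 by [A0]. *)
Lemma serre_singular (A2 : forall i, A i i = 2)
    (A0 : forall i j, A i j = 0 -> A j i = 0) i j (N : nat) :
  i != j -> A i j = - N%:Z ->
  forall k, br (f k) (iter N.+1 (br (e i)) (e j)) = 0.
Proof.
move=> ij AN k; case: (eqVneq k i) => [->|ki].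
  rewrite (string_f hL (h := h i) (N := N)) ?subrr ?mulr0 ?scale0r //.
  - by rewrite (chev_ef hc) eqxx.
  - by rewrite (chev_he hc) A2.
  - by rewrite (brC hL) (chev_ef hc) eq_sym (negbTE ij) oppr0.
  - by rewrite (chev_he hc) AN rmorphN.
have comm x s : br (f k) (iter s (br (e i)) x) = iter s (br (e i)) (br (f k) x).
  elim: s => //= s IHs; rewrite (br_leibniz hL) IHs (brC hL (f k) (e i)).
  by rewrite (chev_ef hc) eq_sym (negbTE ki) oppr0 (br0l hL) add0r.
rewrite comm (brC hL) (chev_ef hc); case: eqP => _; last first.
  by rewrite oppr0; elim: N.+1 => //= s ->; rewrite (br0r hL).
rewrite iterSr (brNr hL) (brC hL) opprK (chev_he hc).
case: N AN => [/A0 -> | N _]; last first.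
  rewrite iterSr (br_Zr hL) (br_xx hL) scaler0.
  by elim: N => //= N ->; rewrite (br0r hL).
by rewrite scale0r.
Qed.

End Triangular.

(** * The presented algebra g~(A) and its radical *)

Section TildeAlgebra.
Local Open Scope quotient_scope.
Variables (K : numClosedFieldType) (n : nat) (A : 'M[int]_n).
Local Notation term := (lterm K n).
Local Notation teq := (@tilde_eq K n A).

Let teqb : rel term := [rel t u | `[< teq t u >]].

Let teqb_refl : reflexive teqb.
Proof. by move=> t; apply/asboolP; apply: tilde_refl. Qed.

Let teqb_sym : symmetric teqb.
Proof. by move=> t u; apply/asboolP/asboolP; apply: tilde_sym. Qed.

Let teqb_trans : transitive teqb.
Proof.
by move=> u t v /asboolP tu /asboolP uv; apply/asboolP; apply: tilde_trans tu uv.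
Qed.

Definition tilde_equiv : equiv_rel term :=
  EquivRel teqb teqb_refl teqb_sym teqb_trans.

(** Passing to the quotient turns provable equality of terms into equality, so that the lemmas on
    brackets apply to g~(A). *)
Definition tla : Type := {eq_quot tilde_equiv}.
HB.instance Definition _ := Choice.on tla.
HB.instance Definition _ := EqQuotient.on tla.

Lemma tla_piP t u : \pi_tla t = \pi_tla u <-> teq t u.
Proof.
split=> [/eqP|tu]; last by apply/eqP; rewrite piE; apply/asboolP.
by rewrite piE => /asboolP.
Qed.

Lemma tla_reprK t : teq (repr (\pi_tla t)) t.
Proof. by apply/tla_piP; rewrite reprK. Qed.

Definition tla_add : tla -> tla -> tla := lift_op2 tla Tadd.
Definition tla_scale (c : K) : tla -> tla := lift_op1 tla (Tscale c).
Definition tla_lie : tla -> tla -> tla := lift_op2 tla Tbr.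

Lemma tla_pi_add t u : tla_add (\pi_tla t) (\pi_tla u) = \pi_tla (Tadd t u).
Proof. by rewrite /tla_add -lock; apply/tla_piP/tilde_congD; apply: tla_reprK. Qed.

Lemma tla_pi_scale c t : tla_scale c (\pi_tla t) = \pi_tla (Tscale c t).
Proof. by rewrite /tla_scale -lock; apply/tla_piP/tilde_congZ/tla_reprK. Qed.

Lemma tla_pi_lie t u : tla_lie (\pi_tla t) (\pi_tla u) = \pi_tla (Tbr t u).
Proof. by rewrite /tla_lie -lock; apply/tla_piP/tilde_congB; apply: tla_reprK. Qed.

Let tlaE := (tla_pi_add, tla_pi_scale, tla_pi_lie).

Let tla_addA : associative tla_add.
Proof.
elim/quotP=> t _; elim/quotP=> u _; elim/quotP=> v _.
by rewrite !tlaE; apply/tla_piP/tilde_addA.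
Qed.

Let tla_addC : commutative tla_add.
Proof.
by elim/quotP=> t _; elim/quotP=> u _; rewrite !tlaE; apply/tla_piP/tilde_addC.
Qed.

Let tla_add0 : left_id (\pi_tla Tzero) tla_add.
Proof. by elim/quotP=> t _; rewrite !tlaE; apply/tla_piP/tilde_add0. Qed.

Let tla_addN : left_inverse (\pi_tla Tzero) (tla_scale (-1)) tla_add.
Proof. by elim/quotP=> t _; rewrite !tlaE; apply/tla_piP/tilde_addN. Qed.

HB.instance Definition _ :=
  GRing.isZmodule.Build tla tla_addA tla_addC tla_add0 tla_addN.

Let pi_tlaD t u : \pi_tla (Tadd t u) = \pi_tla t + \pi_tla u.
Proof. by rewrite -tla_pi_add. Qed.

Let tla_scaleA c d x : tla_scale c (tla_scale d x) = tla_scale (c * d) x.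
Proof. by elim/quotP: x => t _; rewrite !tlaE; apply/tla_piP/tilde_scaleA. Qed.

Let tla_scale1 : left_id 1 tla_scale.
Proof. by elim/quotP=> t _; rewrite tlaE; apply/tla_piP/tilde_scale1. Qed.

Let tla_scaleDr : right_distributive tla_scale +%R.
Proof.
move=> c; elim/quotP=> t _; elim/quotP=> u _.
by rewrite !tlaE -!pi_tlaD tlaE; apply/tla_piP/tilde_scaleDr.
Qed.

Let tla_scaleDl x : {morph tla_scale^~ x : c d / c + d}.
Proof.
by elim/quotP: x => t _ c d; rewrite !tlaE -pi_tlaD; apply/tla_piP/tilde_scaleDl.
Qed.

HB.instance Definition _ :=
  GRing.Zmodule_isLmodule.Build K tla tla_scaleA tla_scale1 tla_scaleDr tla_scaleDl.

Let pi_tlaZ c t : \pi_tla (Tscale c t) = c *: \pi_tla t.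
Proof. by rewrite -tla_pi_scale. Qed.

Lemma tla_bracket : lie_bracket tla_lie.
Proof.
split.
- elim/quotP=> t _; elim/quotP=> u _; elim/quotP=> v _.
  by rewrite -!pi_tlaD !tla_pi_lie -!pi_tlaD; apply/tla_piP/tilde_brDl.
- elim/quotP=> t _; elim/quotP=> u _; elim/quotP=> v _.
  by rewrite -!pi_tlaD !tla_pi_lie -!pi_tlaD; apply/tla_piP/tilde_brDr.
- move=> c; elim/quotP=> t _; elim/quotP=> u _.
  by rewrite -!pi_tlaZ !tla_pi_lie -!pi_tlaZ; apply/tla_piP/tilde_brZl.
- move=> c; elim/quotP=> t _; elim/quotP=> u _.
  by rewrite -!pi_tlaZ !tla_pi_lie -!pi_tlaZ; apply/tla_piP/tilde_brZr.
- by elim/quotP=> t _; rewrite tla_pi_lie; apply/tla_piP/tilde_br_alt.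
- elim/quotP=> t _; elim/quotP=> u _; elim/quotP=> v _.
  by rewrite !tla_pi_lie -!pi_tlaD; apply/tla_piP/tilde_jacobi.
Qed.

Local Notation te := (fun i => \pi_tla (Te i)).
Local Notation tf := (fun i => \pi_tla (Tf i)).
Local Notation th := (fun i => \pi_tla (Th i)).

Lemma tla_chevalley : chevalley A tla_lie te tf th.
Proof.
split=> [|i j|i j|i j|i j]; first exact: tla_bracket.
- by rewrite tla_pi_lie; apply/tla_piP/tilde_hh.
- by rewrite tla_pi_lie (iffRL (tla_piP _ _) (tilde_ef K A i j)); case: eqP.
- by rewrite tla_pi_lie -pi_tlaZ; apply/tla_piP/tilde_he.
- by rewrite tla_pi_lie -pi_tlaZ; apply/tla_piP/tilde_hf.
Qed.

Lemma tla_gen : lie_gen tla_lie te tf th.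
Proof.
move=> P P0 Pl Pb Pe Pf Ph; elim/quotP=> t _.
elim: t => [//|//|//|//|t IHt u IHu|c t IHt|t IHt u IHu].
- by rewrite pi_tlaD -[\pi_tla t]scale1r; apply: Pl.
- by rewrite pi_tlaZ -[_ *: _]addr0; apply: Pl.
- by rewrite -tla_pi_lie; apply: Pb.
Qed.

Hypothesis A_inj : forall g, (forall i, pairing A i g = 0) -> g = 0.

(** The ideal of [singular_ideal] is spanned by monomials of nonzero degree, while the elements
    [hterm c] have weight 0. It therefore meets the Cartan subalgebra trivially and is contained in
    the radical. *)
Lemma singular_radical w i :
  (forall k, tla_lie (tf k) (mono tla_lie te (w, i)) = 0) ->
  forall t, \pi_tla t = mono tla_lie te (w, i) -> radical A t.
Proof.
move=> sing t tE J _; apply; last first.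
- rewrite -/(\pi_tla t) in tE *.
  instantiate (1 := fun u => lspan (fun w' => mono tla_lie te (w' ++ w, i)) (\pi_tla u)).
  by rewrite /= tE; apply: (lspan_gen _ [::]).
- move=> c Ic; apply/tla_piP.
  have wh : weight A tla_lie th 0 (\pi_tla (hterm c)).
    rewrite /hterm; elim: (enum _) => [|j s IHs] /=.
      exact: (weight0 tla_chevalley).
    rewrite pi_tlaD pi_tlaZ; apply: (weightD tla_chevalley) IHs.
    exact/(weightZ tla_chevalley)/(weight_h tla_chevalley).
  apply: (lspan_weight_ind tla_chevalley A_inj
    (fun w' => weight_mono_e tla_chevalley (w' ++ w, i)) (P := eq^~ 0) _ _ _ Ic wh).
  + by [].
  + by move=> ? ? ? -> ->; rewrite scaler0 addr0.
  (* The letter [i] occurs in each of these monomials, so none has degree 0. *)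
  + by move=> w' /rowP/(_ i); rewrite !mxE /= eqxx.
- split=> [u u' /tla_piP <- //||||].
  + exact: lspan0.
  + by move=> u u'; rewrite pi_tlaD; apply: lspanD.
  + by move=> c u; rewrite pi_tlaZ; apply: lspanZ.
  + move=> u u'; rewrite -tla_pi_lie.
    exact: (singular_ideal tla_chevalley tla_gen sing).
Qed.

End TildeAlgebra.

(** * Serre relations in g(A) *)

Section KacMoodyStructure.
Local Open Scope quotient_scope.
Variables (K : numClosedFieldType) (n : nat) (A : 'M[int]_n).
Local Notation km := (km K A).
Local Notation e := (@km_e K n A).
Local Notation f := (@km_f K n A).
Local Notation h := (@km_h K n A).

Lemma km_bracket : lie_bracket (@lie K n A).
Proof.
split; [exact: lieDl|exact: lieDr|exact: lieZl|exact: lieZr|exact: liexx|].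
exact: lie_jacobi.
Qed.

Lemma km_chevalley : chevalley A (@lie K n A) e f h.
Proof.
split; [exact: km_bracket|exact: lie_hh|exact: lie_ef|exact: lie_he|].
exact: lie_hf.
Qed.

Lemma km_gen : lie_gen (@lie K n A) e f h.
Proof.
move=> P P0 Pl Pb Pe Pf Ph; elim/quotP=> t _.
elim: t => [//|//|//|//|t IHt u IHu|c t IHt|t IHt u IHu].
- by rewrite pi_kmD -[\pi_km t]scale1r; apply: Pl.
- by rewrite pi_kmZ -[_ *: _]addr0; apply: Pl.
- by rewrite pi_kmB; apply: Pb.
Qed.

Hypothesis A_inj : forall g, (forall i, pairing A i g = 0) -> g = 0.
Hypothesis A2 : forall i, A i i = 2.
Hypothesis A0 : forall i j, A i j = 0 -> A j i = 0.

(** The term [t] is read in both quotients: in g~(A) it is a singular monomial, so it lies in the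
    radical and becomes 0 in g(A). *)
Lemma serre i j (N : nat) :
  i != j -> A i j = - N%:Z -> iter N.+1 (lie (e i)) (e j) = 0.
Proof.
move=> ij AN; pose t := iter N.+1 (Tbr (Te i)) (Te j) : lterm K n.
have -> : iter N.+1 (lie (e i)) (e j) = \pi_km t.
  by rewrite /t; elim: N.+1 => //= s ->; rewrite pi_kmB.
have monoE : mono (@tla_lie K n A) (fun k => \pi_(tla K A) (Te k)) (nseq N.+1 i, j) =
    iter N.+1 (tla_lie (\pi_(tla K A) (Te i))) (\pi_(tla K A) (Te j)).
  by rewrite /mono; elim: N.+1 => //= s ->.
have rt : radical A t.
  apply: (singular_radical A_inj (w := nseq N.+1 i) (i := j)).
    move=> k; rewrite monoE; apply: (serre_singular (tla_chevalley K A)) => //.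
  rewrite monoE /t; elim: N.+1 => //= s <-; exact/esym/tla_pi_lie.
rewrite -(pi_km0 K A); apply/km_piP.
have tE : tilde_eq A t (Tadd t (Tscale (-1) Tzero)).
  apply: tilde_sym; apply: tilde_trans (tilde_congD (tilde_refl _ _) (tilde_scaler0 _ _)) _.
  exact: tilde_trans (tilde_addC _ _ _) (tilde_add0 _ _).
exact: (ideal_eq (radical_ideal K A) tE rt).
Qed.

End KacMoodyStructure.

(** * Diagonalization of [e - f] on a finite string *)

(* A finite-dimensional lowest weight sl_2-module of dimension N + 1 is
   identified with the polynomials of degree at most N, on which e and f act as
   NX - X^2 d/dX and d/dX.  There e - f has the eigenvectors
   (1 + iX)^k (1 - iX)^(N - k), with eigenvalues (N - 2k)i. *)
Section SL2String.
Variables (K : numClosedFieldType) (L : lmodType K) (br : L -> L -> L).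
Hypothesis hL : lie_bracket br.
Variables (e f h v : L) (N : nat).
Hypotheses (ef : br e f = h) (he : br h e = 2 *: e).
Hypotheses (fv : br f v = 0) (hv : br h v = - N%:R *: v).
Hypothesis eN : iter N.+1 (br e) v = 0.

(** The monomial X^s stands for [(N - s)!] times e^s v; with this normalization [f] acts exactly as
    d/dX. Coefficients beyond degree [N] are ignored. *)
Definition string_vec (p : {poly K}) : L :=
  \sum_(s < N.+1) (p`_s * (N - s)`!%:R) *: iter s (br e) v.

Lemma string_vecP c p q : string_vec (c *: p + q) = c *: string_vec p + string_vec q.
Proof.
rewrite /string_vec scaler_sumr -big_split /=; apply: eq_bigr => s _.
by rewrite coefD coefZ mulrDl scalerDl scalerA mulrA.
Qed.

Lemma string_vec0 : string_vec 0 = 0.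
Proof. by rewrite /string_vec big1 // => s _; rewrite coef0 mul0r scale0r. Qed.

Lemma string_vecB p q : string_vec (p - q) = string_vec p - string_vec q.
Proof. by rewrite [p - q]addrC -[- q]scaleN1r string_vecP scaleN1r addrC. Qed.

Lemma string_vecZ c p : string_vec (c *: p) = c *: string_vec p.
Proof. by rewrite -[_ *: p]addr0 string_vecP string_vec0 addr0. Qed.

Lemma string_vec_sum I (s : seq I) (F : I -> {poly K}) :
  string_vec (\sum_(i <- s) F i) = \sum_(i <- s) string_vec (F i).
Proof.
elim: s => [|i s IHs]; first by rewrite !big_nil string_vec0.
by rewrite !big_cons -{1}[F i]scale1r string_vecP scale1r IHs.
Qed.

Lemma string_vec1 : string_vec 1 = N`!%:R *: v.
Proof.
rewrite /string_vec big_ord_recl big1 => [|s _]; last by rewrite coef1 mul0r scale0r.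
by rewrite coef1 mul1r subn0 addr0.
Qed.

Lemma br_e_string p :
  br e (string_vec p) = string_vec ('X * (N%:R *: p - 'X * p^`())).
Proof.
rewrite /string_vec (br_sumr hL) big_ord_recr big_ord_recl /= coefXM mul0r scale0r.
rewrite add0r (br_Zr hL) -iterS eN scaler0 addr0.
apply: eq_bigr => s _; rewrite (br_Zr hL) /=; congr (_ *: _).
rewrite coefXM /= coefB coefZ coefXM.
have -> : (if s == 0%N :> nat then 0 else p^`()`_s.-1) = s%:R * p`_s.
  by case: (s : nat) => [|t]; rewrite ?mul0r // coef_deriv mulr_natl.
rewrite /bump /= add1n; have sN := ltn_ord s.
have -> : (N - s)`! = ((N - s) * (N - s.+1)`!)%N.
  by rewrite -[in LHS](subnSK sN) factS subnSK.
by rewrite natrM natrB ?(ltnW sN) //; ring.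
Qed.

(** The size bound matters: [string_vec] drops a term in X^(N+1), but the derivative of that term
    would be visible in degree [N]. *)
Lemma br_f_string (p : {poly K}) : (size p <= N.+1)%N ->
  br f (string_vec p) = string_vec p^`().
Proof.
move=> sp; rewrite /string_vec (br_sumr hL) big_ord_recl [RHS]big_ord_recr /=.
rewrite (br_Zr hL) fv scaler0 add0r coef_deriv (nth_default _ sp) mul0rn mul0r.
rewrite scale0r addr0; apply: eq_bigr => s _.
rewrite (br_Zr hL) (string_f hL ef he fv hv) scalerA; congr (_ *: _).
rewrite coef_deriv /bump /= add1n -mulr_natr; have sN := ltn_ord s.
have -> : (N - s)`! = ((N - s) * (N - s.+1)`!)%N.
  by rewrite -[in LHS](subnSK sN) factS subnSK.
by rewrite natrM natrB ?(ltnW sN) //; ring.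
Qed.

Lemma rotation_string (p : {poly K}) c : (size p <= N.+1)%N ->
  N%:R *: ('X * p) - (1 + 'X^2) * p^`() = c *: p ->
  br (e - f) (string_vec p) = c *: string_vec p.
Proof.
move=> sp pE; rewrite (br_Dl hL) (brNl hL) br_e_string br_f_string //.
rewrite -string_vecB -string_vecZ -pE; congr string_vec.
by rewrite mulrBr -scalerAr mulrDl mul1r; ring.
Qed.

Definition rotation_poly k : {poly K} :=
  (1 + 'i *: 'X) ^+ k * (1 - 'i *: 'X) ^+ (N - k).

(** With P = 1 + iX and Q = 1 - iX one has PQ = 1 + X^2, P' = i and Q' = -i. The eigenvalue equation
    reduces to NX - ikQ + i(N - k)P = i(N - 2k). *)
Lemma rotation_poly_string k : (k <= N)%N ->
  br (e - f) (string_vec (rotation_poly k)) =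
  ((N%:Z - 2 * k%:Z)%:~R * 'i) *: string_vec (rotation_poly k).
Proof.
move=> kN; apply: rotation_string.
  have sz (c : K) m : (size ((1 + c *: 'X) ^+ m : {poly K}) <= m.+1)%N.
    apply: leq_trans (size_poly_exp_leq _ _) _; rewrite ltnS -[leqRHS]mul1n.
    rewrite leq_mul2r -subn1 leq_subLR; apply/orP; right.
    apply: leq_trans (size_polyD _ _) _; rewrite geq_max size_poly1 /=.
    by apply: leq_trans (size_scale_leq _ _) _; rewrite size_polyX.
  apply: leq_trans (size_polyMleq _ _) _; rewrite -scaleNr.
  rewrite -subn1 leq_subLR.
  by apply: leq_trans (leq_add (sz 'i k) (sz (- 'i) (N - k)%N)) _; lia.
rewrite /rotation_poly derivM !deriv_exp.
have dp : (1 + 'i *: 'X : {poly K})^`() = 'i%:P.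
  by rewrite derivD derivZ derivX -[1]/(1%:P) derivC add0r alg_polyC.
have dq : (1 - 'i *: 'X : {poly K})^`() = - 'i%:P.
  by rewrite derivB derivZ derivX -[1]/(1%:P) derivC sub0r alg_polyC.
rewrite dp dq; set P := 1 + _; set Q := 1 - _.
have i2 : ('i%:P : {poly K}) ^+ 2 = -1 by rewrite -polyC_exp sqrCi polyCN.
have PQ : 1 + 'X^2 = P * Q.
  rewrite /P /Q -!mul_polyC.
  by transitivity (1 - 'i%:P ^+ 2 * 'X^2 : {poly K}); [rewrite i2; ring|ring].
have pred m (p : {poly K}) : p * (p ^+ m.-1 *+ m) = p ^+ m *+ m.
  by case: m => [|m]; rewrite ?mulr0n ?mulr0 // mulrnAr -exprS.
have E (j p q s1 s2 s3 s4 : {poly K}) : p * q * (j * s1 * s2 + s3 * (- j * s4)) =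
    j * q * (p * s1) * s2 - j * p * s3 * (q * s4) by ring.
rewrite PQ -!mulrnAr E.
rewrite !pred -!mul_polyC -(mulr_natr (P ^+ k)) -(mulr_natr (Q ^+ _)) natrB //.
(* [ring] does not know that j^2 = -1; the two sides differ by a multiple of 1 + j^2. *)
have F (j x p q s t N' k' : {poly K}) : j ^+ 2 = -1 -> p = 1 + j * x -> q = 1 - j * x ->
    N' * (x * (s * t)) - (j * q * (s * k') * t - j * p * s * (t * (N' - k'))) =
    (N' - 2 * k') * j * (s * t).
  move=> j2 -> ->; transitivity ((N' * x * (1 + j ^+ 2) + (N' - 2 * k') * j) * (s * t)).
    by ring.
  by rewrite j2 subrr mulr0 add0r.
rewrite -[X in X * ('X * _)]/(N%:R%:P) polyCM rmorph_int rmorphB rmorphM /=.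
rewrite polyC_natr; apply: F; rewrite ?[_%:P * 'X]mul_polyC //.
Qed.

(** Binomial expansion of 2^N = (Q + P)^N with P = 1 + iX and Q = 1 - iX: the lowest weight vector
    is a combination of eigenvectors of [e - f]. *)
Lemma lowest_rotation_poly :
  (2 ^+ N * N`!%:R) *: v = \sum_(k < N.+1) 'C(N, k)%:R *: string_vec (rotation_poly k).
Proof.
rewrite -scalerA -string_vec1 -string_vecZ.
under eq_bigr do rewrite -string_vecZ.
rewrite -string_vec_sum; congr string_vec.
have -> : 2 ^+ N *: 1 = ((1 - 'i *: 'X) + (1 + 'i *: 'X)) ^+ N :> {poly K}.
  rewrite addrCA subrK alg_polyC rmorphXn /= polyC_natr.
  by congr (_ ^+ _); rewrite -natr1.
rewrite exprDn; apply: eq_bigr => k _.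
by rewrite /rotation_poly mulrC scaler_nat.
Qed.

End SL2String.

(** * The quarter turn as a relation *)

Section Rotation.
Variables (K : numClosedFieldType) (L : lmodType K) (br : L -> L -> L).
Hypothesis hL : lie_bracket br.
Variable u : L.

(* [rotation] is the graph of exp((pi/2) ad u) when ad u is diagonalizable with
   eigenvalues in iZ: no convergence is needed in this form. *)
Inductive rotation : L -> L -> Prop :=
| rotation_eigen k z : br u z = (k%:~R * 'i) *: z -> rotation z ('i ^ k *: z)
| rotation_add x y x' y' : rotation x y -> rotation x' y' -> rotation (x + x') (y + y').

Lemma rotation_fix z : br u z = 0 -> rotation z z.
Proof.
move=> uz; rewrite -[X in rotation _ X]scale1r -(expr0z ('i : K)).
by apply: rotation_eigen; rewrite uz mul0r scale0r.
Qed.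

Lemma rotationZ c x y : rotation x y -> rotation (c *: x) (c *: y).
Proof.
elim=> [k z uz|{}x {}y x' y' _ IH _ IH']; last by rewrite !scalerDr; apply: rotation_add.
rewrite scalerA mulrC -scalerA; apply: rotation_eigen.
by rewrite (br_Zr hL) uz !scalerA mulrC.
Qed.

Lemma rotationP c x y x' y' : rotation x y -> rotation x' y' ->
  rotation (c *: x + x') (c *: y + y').
Proof. by move=> xy; apply/rotation_add/rotationZ. Qed.

Lemma rotationB x y x' y' : rotation x y -> rotation x' y' -> rotation (x - x') (y - y').
Proof.
move=> xy /(rotationZ (-1)) xy'.
by rewrite -[x']scale1r -[y']scale1r -!scaleNr; apply: rotation_add.
Qed.

Lemma rotation_sum I (s : seq I) (F G : I -> L) :
  (forall i, rotation (F i) (G i)) -> rotation (\sum_(i <- s) F i) (\sum_(i <- s) G i).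
Proof.
move=> FG; elim: s => [|i s IHs]; last by rewrite !big_cons; apply: rotation_add.
by rewrite !big_nil; apply: rotation_fix; rewrite (br0r hL).
Qed.

(** The exponential of a derivation is an automorphism: eigenvalues add under the bracket, so the
    powers of i multiply. *)
Lemma rotation_br x y x' y' : rotation x y -> rotation x' y' -> rotation (br x x') (br y y').
Proof.
move=> xy; elim: xy x' y' => [k z uz|{}x {}y a b _ IH _ IH'] x' y' xy'; last first.
  by rewrite !(br_Dl hL); apply: rotation_add; [apply: IH|apply: IH'].
elim: xy' => [l t ut|{}x' {}y' a b _ IH _ IH'].
  rewrite (br_Zl hL) (br_Zr hL) scalerA -expfzDr ?neq0Ci //; apply: rotation_eigen.
  rewrite (br_leibniz hL) uz ut (br_Zl hL) (br_Zr hL) -scalerDl.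
  by rewrite -mulrDl rmorphD.
by rewrite !(br_Dr hL); apply: rotation_add.
Qed.

Let eigen := {m : int * L | br u m.2 = (m.1%:~R * 'i) *: m.2}.
Let key (t : eigen) : int := (sval t).1.
Let vec (t : eigen) : L := (sval t).2.

Let rotation_eigenvectors x y : rotation x y ->
  exists s : seq eigen,
    x = \sum_(t <- s) vec t /\ y = \sum_(t <- s) 'i ^ key t *: vec t.
Proof.
elim=> [k z uz|{}x {}y x' y' _ [s [-> ->]] _ [s' [-> ->]]].
  by exists [:: exist _ (k, z) uz : eigen]; rewrite !big_seq1.
by exists (s ++ s'); rewrite !big_cat.
Qed.

(** If eigenvectors sum to 0, so does the part belonging to each eigenvalue, and weights depending
    only on the eigenvalue do no harm. The induction on the size removes all terms sharing the key
    of the head. *)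
Let eigen_sum0 (c : int -> K) (s : seq eigen) :
  \sum_(t <- s) vec t = 0 -> \sum_(t <- s) c (key t) *: vec t = 0.
Proof.
move: {2}(size s) (leqnn (size s)) => N; elim: N s => [|N IHN] [|t s] //.
1-2: by rewrite !big_nil.
move=> sN s0; set r := t :: s in s0 *; pose k := key t.
have y0 : 0 = \sum_(t <- r | key t == k) vec t.
  apply: (@eigen_sep _ _ unit eigen (fun=> br u) _ _ (fun t _ => (key t)%:~R * 'i)
    (fun=> k%:~R * 'i) vec 0 _ [seq t <- r | key t != k]).
  - by move=> _ ? ?; rewrite (br_Dr hL).
  - by move=> _ ? ?; rewrite (br_Zr hL).
  - by move=> _; rewrite (br0r hL) scaler0.
  - move=> _; rewrite (br_sumr hL) scaler_sumr; apply: eq_bigr => t' /eqP <-.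
    exact: (svalP t').
  - by move=> t' _; apply: (svalP t').
  - move=> j jr t0; exists tt.
    have /(all_nthP t0)/(_ _ jr) := filter_all (fun t => key t != k) r.
    by apply: contraNN => /eqP/(mulIf (neq0Ci K))/eqP; rewrite eqr_int.
  by rewrite big_filter -[LHS]s0 (bigID (fun t => key t == k)).
rewrite (bigID (fun t => key t == k)) /=.
have -> : \sum_(t <- r | key t == k) c (key t) *: vec t = 0.
  transitivity (c k *: \sum_(t <- r | key t == k) vec t); last by rewrite -y0 scaler0.
  by rewrite scaler_sumr; apply: eq_bigr => t' /eqP ->.
rewrite add0r -big_filter; apply: IHN.
  rewrite /r /= eqxx /=; apply: leq_trans (_ : size s <= N)%N => //.
  by rewrite size_filter count_size.
by rewrite big_filter; move: s0; rewrite (bigID (fun t => key t == k)) /= -y0 add0r.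
Qed.

(** The graph is linear, so it suffices that 0 rotates only to 0: this is [eigen_sum0] with the
    weights i^k. *)
Lemma rotation_fun x y y' : rotation x y -> rotation x y' -> y = y'.
Proof.
move=> xy xy'; apply/eqP; rewrite -subr_eq0; apply/eqP.
have [s [/esym]] := rotation_eigenvectors (rotationB xy xy').
by rewrite subrr => /(eigen_sum0 (exprz 'i)) -> ->.
Qed.

(** The rotated eigenvectors keep their eigenvalues, so the weights i^(-k) undo the rotation. *)
Lemma rotation_inj x x' y : rotation x y -> rotation x' y -> x = x'.
Proof.
move=> xy xy'; apply/eqP; rewrite -subr_eq0; apply/eqP.
have [s [-> /esym]] := rotation_eigenvectors (rotationB xy xy'); rewrite subrr.
have scaleE (t : eigen) : br u ('i ^ key t *: vec t) =
    ((key t)%:~R * 'i) *: ('i ^ key t *: vec t).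
  by rewrite (br_Zr hL) (svalP t) !scalerA mulrC.
pose scale t : eigen := exist _ (key t, 'i ^ key t *: vec t) (scaleE t).
rewrite -(big_map scale predT vec) => /(eigen_sum0 (fun k => 'i ^ (- k))).
rewrite big_map => E; rewrite -[RHS]E; apply: eq_bigr => t _.
by rewrite /key /vec /= scalerA -expfzDr ?neq0Ci // addNr expr0z scale1r.
Qed.

End Rotation.

(** * Weight spaces of g(A) and the compact involution *)

Section KacMoodyRoots.
Variables (K : numClosedFieldType) (n : nat) (A : 'M[int]_n).
Local Notation km := (km K A).
Local Notation e := (@km_e K n A).
Local Notation f := (@km_f K n A).
Local Notation h := (@km_h K n A).
Local Notation wt := (weight A (@lie K n A) h).
Let hc := km_chevalley K A.
Let hL := chev_br hc.

Variable omega : km -> km.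
Hypothesis homega : compact_involution omega.

Lemma omegaD x y : omega (x + y) = omega x + omega y.
Proof. exact: omega_D. Qed.

Lemma omegaZ c x : omega (c *: x) = c^* *: omega x.
Proof. exact: omega_Z. Qed.

Lemma omegaN x : omega (- x) = - omega x.
Proof. by rewrite -scaleN1r omegaZ rmorphN rmorph1 scaleN1r. Qed.

Lemma omega0 : omega 0 = 0.
Proof. by rewrite -[0](scale0r 0) omegaZ rmorph0 !scale0r. Qed.

Lemma omega_lieE x y : omega (lie x y) = lie (omega x) (omega y).
Proof. exact: omega_lie. Qed.

Lemma omega_h i : omega (h i) = - h i.
Proof.
have -> : h i = lie (e i) (f i) by rewrite lie_ef eqxx.
rewrite omega_lieE (omega_e homega) (omega_f homega) (brNl hL) (brNr hL) opprK.
by rewrite (brC hL).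
Qed.

Lemma weight_omega g x : wt g x -> wt (- g) (omega x).
Proof.
move=> wx i; rewrite -[h i]opprK (brNl hL) -omega_h -omega_lieE wx omegaZ.
by rewrite rmorph_int pairingN rmorphN scaleNr.
Qed.

Lemma omega_eq0 x : omega x = 0 -> x = 0.
Proof. by move=> x0; apply: (bij_inj (omega_bij homega)); rewrite x0 omega0. Qed.

Hypothesis A_inj : forall g, (forall i, pairing A i g = 0) -> g = 0.
Hypothesis A2 : forall i, A i i = 2.
Hypothesis A_sym : forall i j, A i j = A j i.
Hypothesis A_neg : forall i j, i != j -> A i j <= 0.

(** The triangular decomposition in the form used below: only spanning elements whose degree is the
    given weight have to be examined. *)
Lemma weight_ind (P : km -> Prop) g :
  P 0 -> (forall c x y, P x -> P y -> P (c *: x + y)) ->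
  (forall m, deg m = g -> P (mono (@lie K n A) e m)) ->
  (forall m, - deg m = g -> P (mono (@lie K n A) f m)) ->
  (g = 0 -> forall i, P (h i)) ->
  forall x, wt g x -> P x.
Proof.
move=> P0 PP Pe Pf Ph x.
apply: (lspan_weight_ind hc A_inj (weight_tri hc)) (span_tri hc (@km_gen K n A) x) => //.
by move=> [[m|m]|i] //= g0; [apply: Pe|apply: Pf|apply: Ph].
Qed.

Lemma deg_ge0 (m : seq 'I_n * 'I_n) k : 0 <= deg m 0 k.
Proof. by rewrite mxE. Qed.

Lemma deg_gt0 (m : seq 'I_n * 'I_n) k : k \in m.2 :: m.1 -> 0 < deg m 0 k.
Proof. by rewrite mxE -has_pred1 has_count ltz_nat. Qed.

(** The degree of a spanning element has coordinates all of one sign. *)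
Lemma weight_mixed (g : 'rV[int]_n) x k l : g 0 k < 0 -> 0 < g 0 l -> wt g x -> x = 0.
Proof.
move=> gk gl; apply: (weight_ind (P := eq^~ 0)) => //.
- by move=> ? ? ? -> ->; rewrite scaler0 addr0.
- by move=> m mg; move: gk; rewrite -mg ltNge deg_ge0.
- by move=> m mg; move: gl; rewrite -mg mxE oppr_gt0 ltNge deg_ge0.
- by move=> g0; rewrite g0 mxE ltxx in gk.
Qed.

Lemma deg_simple (m : seq 'I_n * 'I_n) (c : int) j : deg m = c *: simple_root j ->
  m.2 = j /\ {in m.1, forall k, k = j}.
Proof.
move=> mj; have H k : k \in m.2 :: m.1 -> k = j.
  move/deg_gt0; rewrite mj !mxE /=; case: eqP => // _.
  by rewrite mulr0 ltxx.
by split=> [|k km]; apply: H; rewrite inE ?eqxx ?km ?orbT.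
Qed.

(** A monomial of degree c alpha_j has [j] as its only letter, at least twice, so its innermost
    bracket is [[e j, e j] = 0]. *)
Lemma weight_multiple (c : int) j x : 1 < c -> wt (c *: simple_root j) x -> x = 0.
Proof.
move=> c1; apply: (weight_ind (P := eq^~ 0)) => //.
- by move=> ? ? ? -> ->; rewrite scaler0 addr0.
- move=> [w i] /[dup] wj /deg_simple /= [ij kj]; rewrite ij in wj *.
  move: wj kj; case/lastP: w => [|w k] wj kj.
    move/rowP/(_ j): wj; rewrite !mxE /= !eqxx mulr1 addn0 => c1'.
    by rewrite -c1' in c1.
  rewrite /mono foldr_rcons (kj k) ?mem_rcons ?inE ?eqxx // liexx.
  by elim: w {wj kj} => //= k' w ->; rewrite (br0r hL).
- move=> m /rowP/(_ j); rewrite !mxE !eqxx mulr1 => mc.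
  by move: c1; rewrite -mc; case: (count_mem _ _).
- move/rowP/(_ j); rewrite !mxE !eqxx mulr1 => c0.
  by rewrite c0 in c1.
Qed.

Lemma weight_simple j x : wt (simple_root j) x -> exists c, x = c *: e j.
Proof.
rewrite -[simple_root j]scale1r.
apply: (weight_ind (P := fun x => exists c, x = c *: e j)).
- by exists 0; rewrite scale0r.
- move=> c _ _ [a ->] [b ->]; exists (c * a + b).
  by rewrite scalerDl scalerA.
- move=> [w i] /[dup] wj /deg_simple /= [ij kj]; rewrite ij in wj *.
  case: w wj kj => [|k w] wj kj; first by exists 1; rewrite scale1r.
  move/rowP/(_ j): wj; rewrite !mxE /= (kj k) ?mem_head // !eqxx mulr1.
  by move=> [].
- move=> m /rowP/(_ j); rewrite !mxE !eqxx mulr1.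
  by case: (count_mem _ _).
- by move/rowP/(_ j); rewrite !mxE !eqxx.
Qed.

Lemma lie_subalgebra_nplus : lie_subalgebra (@nplus K n A).
Proof.
split=> [B [[B0 _ _] _] //|c x y nx ny B hB|x y nx ny B hB].
  by have [[_ BP _] _] := hB; apply: BP; [apply: nx|apply: ny].
by have [[_ _ Bl] _] := hB; apply: Bl; [apply: nx|apply: ny].
Qed.

Lemma lie_subalgebra_nminus : lie_subalgebra (@nminus K n A).
Proof.
split=> [B [[B0 _ _] _] //|c x y nx ny B hB|x y nx ny B hB].
  by have [[_ BP _] _] := hB; apply: BP; [apply: nx|apply: ny].
by have [[_ _ Bl] _] := hB; apply: Bl; [apply: nx|apply: ny].
Qed.

Lemma weight_nplus (g : 'rV[int]_n) x : (forall j, 0 <= g 0 j) -> g != 0 -> wt g x -> nplus x.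
Proof.
move=> g0 gn0; have [N0 NP Nl] := lie_subalgebra_nplus.
have Ne i : nplus (e i) by move=> B [_]; apply; exists i.
apply: (weight_ind (P := @nplus K n A)) => //.
- move=> [w i] _; rewrite /mono /=; elim: w => [|k w IHw] /=; first exact: Ne.
  exact: Nl.
- move=> m mg; have := g0 m.2.
  by rewrite -mg mxE oppr_ge0 leNgt deg_gt0 // mem_head.
- by move/eqP; rewrite (negbTE gn0).
Qed.

(** The preimage of n^- under [omega] is a subalgebra containing all [e i]. *)
Lemma nplus_omega x : nplus x -> nminus (omega x).
Proof.
have [N0 NP Nl] := lie_subalgebra_nminus.
move=> nx; apply: (nx [set y | nminus (omega y)]%classic); split; last first.
  move=> _ [i _ <-] /=; rewrite (omega_e homega) -scaleN1r -[_ *: _]addr0.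
  by apply: NP => // B [_]; apply; exists i.
split=> [|c y z ny nz|y z ny nz] /=; first by rewrite omega0.
  by rewrite omegaD omegaZ; apply: NP.
by rewrite omega_lieE; apply: Nl.
Qed.

(** * Rotations lifting the simple reflections *)

Section SimpleRotation.
Variable i : 'I_n.
Let u := e i - f i.
Local Notation rotation := (rotation (@lie K n A) u).

Lemma omega_rotation_axis : omega u = u.
Proof.
by rewrite /u omegaD omegaN (omega_e homega) (omega_f homega) opprK addrC.
Qed.

(** Since [omega] is antilinear and fixes [u], it turns the eigenvalue ik into -ik; the factor i^k
    is conjugated to i^(-k), as required. *)
Lemma rotation_omega x y : rotation x y -> rotation (omega x) (omega y).
Proof.
elim=> [k z uz|{}x {}y x' y' _ IH _ IH']; last by rewrite !omegaD; apply: rotation_add.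
have iE : ('i ^ k)^* = 'i ^ (- k) :> K.
  rewrite rmorphXz ?unitfE ?neq0Ci //= conjCi.
  have -> : - 'i = 'i^-1 :> K by rewrite invCi.
  by rewrite exprz_inv.
rewrite omegaZ iE; apply: rotation_eigen.
rewrite -{1}omega_rotation_axis -omega_lieE uz omegaZ rmorphM /= conjCi rmorph_int.
by rewrite mulrN rmorphN mulNr.
Qed.

(** On the span of [h i] and w = [e i + f i], [ad u] sends [h i] to -2w and w to 2 [h i]. The
    eigenvectors [h i] + iw and [h i] - iw have eigenvalues 2i and -2i, so the quarter turn is -1
    there. *)
Lemma rotation_hi_and_sum : rotation (h i) (- h i) /\ rotation (e i + f i) (- (e i + f i)).
Proof.
pose w := e i + f i.
have uh : lie u (h i) = (-2) *: w.
  rewrite (brC hL) /u (br_Dr hL) (brNr hL) lie_he lie_hf A2 /w.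
  by rewrite !scaleNr opprK scalerDr.
have uw : lie u w = 2 *: h i.
  rewrite /u /w (br_Dl hL) (brNl hL) !(br_Dr hL) !liexx add0r addr0.
  by rewrite (brC hL (f i)) opprK lie_ef eqxx scaler_nat.
have rp : rotation (h i + 'i *: w) ((-1) *: (h i + 'i *: w)).
  rewrite -(sqrCi K); apply: (@rotation_eigen _ _ _ _ 2).
  rewrite (br_Dr hL) (br_Zr hL) uh uw [RHS]scalerDr !scalerA -mulrA -expr2 sqrCi.
  by rewrite mulrN1 addrC [_ * 'i]mulrC.
have rm : rotation (h i - 'i *: w) ((-1) *: (h i - 'i *: w)).
  have -> : -1 = 'i ^ (- 2) :> K by rewrite -[RHS]/('i ^- 2) sqrCi invrN1.
  apply: rotation_eigen.
  rewrite (br_Dr hL) (brNr hL) (br_Zr hL) uh uw -!scaleNr [RHS]scalerDr !scalerA.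
  rewrite rmorphN !mulNr mulrN opprK -mulrA -expr2 sqrCi.
  by rewrite mulrN1 addrC [_ * 'i]mulrC.
have halfD (x : km) : 2^-1 *: (x + x) = x.
  by rewrite -[x]scale1r -scalerDl scalerA mulVf ?pnatr_eq0 // scale1r.
split.
  have := rotationZ hL 2^-1 (rotation_add rp rm); rewrite -scalerDr addrACA subrr addr0.
  by rewrite scalerA mulrC -scalerA halfD scaleN1r.
have := rotationZ hL (2^-1 * 'i^-1) (rotationB hL rp rm).
rewrite -!scalerBr opprB [_ + ('i *: w - _)]addrC addrA subrK -scalerDr.
have wE : (2^-1 * 'i^-1) *: ('i *: (w + w)) = w.
  by rewrite scalerA -mulrA mulVf ?neq0Ci // mulr1 halfD.
by rewrite wE scaleN1r scalerN wE.
Qed.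

(** Subtracting half of a_ji [h i] from [h j] gives an element commuting with [e i] and [f i], hence
    fixed, while [h i] is negated. *)
Lemma rotation_h j : rotation (h j) (h j - (A j i)%:~R *: h i).
Proof.
have [ri _] := rotation_hi_and_sum.
pose c : K := (A j i)%:~R / 2.
have rc : rotation (h j - c *: h i) (h j - c *: h i).
  have c2 : (A j i)%:~R - c * 2 = 0 by rewrite mulfVK ?pnatr_eq0 // subrr.
  have Xe : lie (h j - c *: h i) (e i) = 0.
    by rewrite (br_Dl hL) (brNl hL) (br_Zl hL) !lie_he A2 scalerA -scalerBl c2 scale0r.
  have Xf : lie (h j - c *: h i) (f i) = 0.
    rewrite (br_Dl hL) (brNl hL) (br_Zl hL) !lie_hf A2 scalerA -scalerBl mulrN.
    by rewrite -opprD c2 oppr0 scale0r.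
  by apply: rotation_fix; rewrite /u (brC hL) (br_Dr hL) (brNr hL) Xe Xf subrr oppr0.
have := rotationP hL c ri rc; rewrite addrC subrK.
rewrite scalerN addrCA -opprD -scalerDl.
by rewrite /c -splitr.
Qed.

(** The domain of the relation is a subalgebra, so generators suffice. Twice [e i] is
    [u + (e i + f i)]; for [j <> i], [e j] is a lowest weight vector of weight a_ij for the i-th
    sl_2, with a finite string by the Serre relation, and so a sum of eigenvectors; [f j] follows by
    [omega]. *)
Lemma rotation_ex x : exists y, rotation x y.
Proof.
have [_ rw] := rotation_hi_and_sum.
have ru : rotation u u by apply: rotation_fix; rewrite liexx.
have lin c x1 x2 : (exists y, rotation x1 y) -> (exists y, rotation x2 y) ->
    exists y, rotation (c *: x1 + x2) y.
  by move=> [y1 r1] [y2 r2]; exists (c *: y1 + y2); apply: rotationP.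
have ex0 : exists y, rotation 0 y by exists 0; apply: rotation_fix; rewrite (br0r hL).
have scal c x1 : c != 0 -> (exists y, rotation (c *: x1) y) -> exists y, rotation x1 y.
  move=> c0 [y ry]; exists (c^-1 *: y); rewrite -[x1]scale1r -(mulVf c0) -scalerA.
  exact: rotationZ.
have ei : exists y, rotation (e i) y.
  apply: (scal 2); rewrite ?pnatr_eq0 //.
  have -> : 2 *: e i = 1 *: u + (e i + f i).
    by rewrite scale1r /u addrACA addNr addr0 scaler_nat mulr2n.
  by apply: lin; [exists u|exists (- (e i + f i))].
have ee j : exists y, rotation (e j) y.
  case: (eqVneq j i) => [-> //|ji].
  pose N := `|A i j|%N.
  have AN : A i j = - N%:Z.
    have Aij : A i j <= 0 by apply: A_neg; rewrite eq_sym.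
    by rewrite /N; lia.
  have fe : lie (f i) (e j) = 0.
    by rewrite (brC hL) lie_ef (negbTE ji) oppr0.
  have he : lie (h i) (e j) = - N%:R *: e j by rewrite lie_he AN rmorphN.
  have ef : lie (e i) (f i) = h i by rewrite lie_ef eqxx.
  have hee : lie (h i) (e i) = 2 *: e i by rewrite lie_he A2.
  have eN : iter N.+1 (lie (e i)) (e j) = 0.
    by apply: serre => //; [move=> k l; rewrite A_sym|rewrite eq_sym].
  apply: (scal (2 ^+ N * N`!%:R)).
    by rewrite mulf_neq0 ?expf_neq0 ?pnatr_eq0 // -lt0n fact_gt0.
  rewrite (lowest_rotation_poly (@lie K n A) (e i)).
  elim/big_ind: _ => [//|x1 x2|k _]; first by rewrite -{2}[x1]scale1r; apply: lin.
  rewrite -[_ *: _]addr0; apply: lin => //; eexists; apply: rotation_eigen.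
  by apply: (rotation_poly_string hL ef hee fe he eN); rewrite -ltnS.
have ff j : exists y, rotation (f j) y.
  have [y /rotation_omega] := ee j; rewrite (omega_e homega) => r.
  by exists (- omega y); have := rotationZ hL (-1) r; rewrite !scaleN1r opprK.
move: x; apply: km_gen => //.
- by move=> x1 x2 [y1 r1] [y2 r2]; exists (lie y1 y2); apply: rotation_br.
- by move=> j; eexists; apply: rotation_h.
Qed.

Lemma pairing_reflection j g :
  pairing A j (reflection A i g) = pairing A j g - A j i * pairing A i g.
Proof. by rewrite /reflection pairingD pairingN pairingZ pairing_simple mulrC. Qed.

(** The element [h j] - a_ji [h i] rotates to [h j] and acts on [x] by the pairing of [h j] with
    [g]; rotating this eigenvalue equation gives the one for [y]. *)
Lemma rotation_weight g x y : wt (reflection A i g) x -> rotation x y -> wt g y.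
Proof.
move=> wx rxy j.
have rj : rotation (h j - (A j i)%:~R *: h i) (h j).
  have := rotationP hL (- (A j i)%:~R) (rotation_h i) (rotation_h j).
  rewrite A2 addrC scaleNr.
  suff -> : - (A j i)%:~R *: (h i - 2%:~R *: h i) + (h j - (A j i)%:~R *: h i) = h j by [].
  have -> : h i - 2%:~R *: h i = - h i.
    by rewrite -[2%:~R]/(1 + 1 : K) scalerDl scale1r opprD addrA subrr add0r.
  by rewrite scalerN scaleNr opprK addrC subrK.
have := rotation_br hL rj rxy; rewrite (br_Dl hL) (brNl hL) (br_Zl hL) !wx scalerA.
rewrite -scalerBl !pairing_reflection A2.
have -> : (pairing A j g - A j i * pairing A i g)%:~R -
    (A j i)%:~R * (pairing A i g - 2 * pairing A i g)%:~R = (pairing A j g)%:~R :> K.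
  by rewrite -rmorphM -rmorphB /=; congr (_%:~R); ring.
by move=> r; apply: (rotation_fun hL r); apply: rotationZ.
Qed.

End SimpleRotation.

(** For symmetric A this identifies the root lattice with a lattice in the Cartan subalgebra; on
    real roots, which have norm 2, it gives the usual coroot. *)
Definition coroot (g : 'rV[int]_n) : km := \sum_j (g 0 j)%:~R *: h j.

Lemma rotation_coroot i g :
  rotation (@lie K n A) (e i - f i) (coroot (reflection A i g)) (coroot g).
Proof.
have cE : coroot (reflection A i g) = coroot g - (pairing A i g)%:~R *: h i.
  rewrite /coroot (bigD1 i) // [in RHS](bigD1 i) //= addrAC; congr (_ + _).
    by rewrite /reflection !mxE !eqxx mulr1 rmorphB scalerBl.
  apply: eq_bigr => j ji.
  by rewrite /reflection !mxE (negbTE ji) andbF mulr0 subr0.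
rewrite cE; have := rotationB hL (rotation_sum hL (index_enum 'I_n)
  (fun j => rotationZ hL (g 0 j)%:~R (rotation_h i j)))
  (rotationZ hL (pairing A i g)%:~R (rotation_h i i)).
rewrite -/(coroot g); set y := (X in rotation _ _ _ X).
suff -> : y = coroot g by [].
rewrite /y; under eq_bigr do rewrite scalerBr.
rewrite sumrB -/(coroot g) A2.
have -> : \sum_(j < n) (g 0 j)%:~R *: ((A j i)%:~R *: h i) = (pairing A i g)%:~R *: h i.
  rewrite /pairing rmorph_sum scaler_suml; apply: eq_bigr => j _.
  by rewrite scalerA -rmorphM A_sym mulrC.
rewrite -[2%:~R]/(1 + 1 : K) scalerDl scale1r opprD addrA subrr add0r scalerN opprK.
by rewrite subrK.
Qed.

(** For x = c [e j] the bracket is -|c|^2 [h j]. In the inductive step x is rotated to a vector with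
    one reflection fewer; the rotation respects brackets, [omega] and coroots, so the same [p]
    serves and injectivity pulls the formula back. *)
Lemma real_root_bracket w j x :
  wt (foldr (reflection A) (simple_root j) w) x -> x != 0 ->
  exists2 p : K, 0 < p &
    lie x (omega x) = - p *: coroot (foldr (reflection A) (simple_root j) w).
Proof.
elim: w x => [|i w IHw] x /= wx x0.
  have [c xE] := weight_simple wx.
  have c0 : c != 0 by apply: contra_neq x0 => c0; rewrite xE c0 scale0r.
  exists (`|c| ^+ 2); first by rewrite exprn_gt0 ?normr_gt0.
  rewrite xE omegaZ (br_Zl hL) (br_Zr hL) scalerA -normCK (omega_e homega).
  rewrite (brNr hL) lie_ef eqxx scalerN scaleNr; congr (- (_ *: _)).
  rewrite /coroot (bigD1 j) //= big1 ?addr0 ?mxE ?eqxx ?scale1r // => k kj.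
  by rewrite !mxE (negbTE kj) andbF scale0r.
have [y rxy] := rotation_ex i x.
have y0 : y != 0.
  apply: contra_neq x0 => y0; apply: (rotation_inj hL rxy); rewrite y0.
  by apply: rotation_fix; rewrite (br0r hL).
have [p p0 yE] := IHw y (rotation_weight wx rxy) y0.
exists p => //; have := rotation_br hL rxy (rotation_omega rxy); rewrite yE => r.
by apply: (rotation_inj hL r); apply/rotationZ/rotation_coroot.
Qed.

End KacMoodyRoots.

(** * The bilinear form on the root lattice *)

Section Bilinear.
Variables (n : nat) (A : 'M[int]_n).

(** The form with Gram matrix A: its value at (g, g') is g' evaluated on [coroot g]. *)
Definition bil (g g' : 'rV[int]_n) : int := \sum_i g 0 i * pairing A i g'.

Lemma root_space_weight (K : numClosedFieldType) g (x : km K A) :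
  root_space g x <-> weight A (@lie K n A) (@km_h K n A) g x.
Proof.
have hL := km_bracket K A; split=> [gx i|wx c].
  have := gx (fun k => (k == i)%:R); rewrite (bigD1 i) //= eqxx scale1r.
  rewrite big1 ?addr0 => [->|k /negbTE->]; last by rewrite scale0r.
  rewrite (bigD1 i) //= eqxx mul1r big1 ?addr0 // => k /negbTE->.
  by rewrite mul0r.
rewrite (br_suml hL) scaler_suml; apply: eq_bigr => i _.
by rewrite (br_Zl hL) wx scalerA.
Qed.

Lemma lie_coroot (K : numClosedFieldType) g g' (x : km K A) :
  weight A (@lie K n A) (@km_h K n A) g' x ->
  lie (coroot K A g) x = (bil g g')%:~R *: x.
Proof.
move/root_space_weight=> /(_ (fun j => (g 0 j)%:~R)) ->; congr (_ *: _).
by rewrite rmorph_sum; apply: eq_bigr => i _; rewrite rmorphM.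
Qed.

End Bilinear.

(** * Integer arithmetic: the conic and the sequence F *)

Lemma sqr_neq4 (a : int) : 3 <= a -> a ^+ 2 - 4 != 0.
Proof.
move=> a3; have -> : a ^+ 2 - 4 = (a - 2) * (a + 2) by ring.
by rewrite mulf_neq0; lia.
Qed.

(** Let p = (x, y), let Q be the quadratic form and B(d) the derivative of Q at p along d. Then Q(p
    + d) = Q(p) means B(d) = -Q(d), and likewise for e. Writing e = td gives t(t - 1)Q(d) = 0; the
    proof clears the denominator [d0] of t. *)
Lemma conic_line_aux (a x y d0 d1 e0 e1 : int) : 3 <= a ->
  x ^+ 2 + y ^+ 2 - a * x * y = 1 ->
  (x + d0) ^+ 2 + (y + d1) ^+ 2 - a * (x + d0) * (y + d1) = 1 ->
  (x + e0) ^+ 2 + (y + e1) ^+ 2 - a * (x + e0) * (y + e1) = 1 ->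
  d0 * e1 = d1 * e0 -> d0 != 0 -> (e0, e1) != (0, 0) -> (e0, e1) != (d0, d1) ->
  False.
Proof.
move=> a3 N0 Nd Ne det d0n en ed.
pose Q u v : int := u ^+ 2 + v ^+ 2 - a * u * v.
pose B u v : int := (2 * x - a * y) * u + (2 * y - a * x) * v.
have Bd : B d0 d1 = - Q d0 d1.
  apply/eqP; rewrite -addr_eq0; apply/eqP.
  transitivity (((x + d0) ^+ 2 + (y + d1) ^+ 2 - a * (x + d0) * (y + d1)) -
    (x ^+ 2 + y ^+ 2 - a * x * y)); first by rewrite /B /Q; ring.
  by rewrite N0 Nd subrr.
have Be : B e0 e1 = - Q e0 e1.
  apply/eqP; rewrite -addr_eq0; apply/eqP.
  transitivity (((x + e0) ^+ 2 + (y + e1) ^+ 2 - a * (x + e0) * (y + e1)) -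
    (x ^+ 2 + y ^+ 2 - a * x * y)); first by rewrite /B /Q; ring.
  by rewrite N0 Ne subrr.
have E1 : d0 ^+ 2 * Q e0 e1 = e0 ^+ 2 * Q d0 d1.
  transitivity (d0 ^+ 2 * e0 ^+ 2 + (d0 * e1) ^+ 2 - a * d0 * e0 * (d0 * e1)).
    by rewrite /Q; ring.
  by rewrite det /Q; ring.
have E2 : d0 * B e0 e1 = e0 * B d0 d1.
  transitivity ((2 * x - a * y) * d0 * e0 + (2 * y - a * x) * (d0 * e1)).
    by rewrite /B; ring.
  by rewrite det /B; ring.
have /eqP : e0 * (e0 - d0) * Q d0 d1 = 0.
  transitivity (e0 ^+ 2 * Q d0 d1 - d0 * (e0 * Q d0 d1)); first by ring.
  rewrite -E1 -[Q d0 d1]opprK -Bd mulrN -E2 Be; ring.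
rewrite !mulf_eq0 => /orP[/orP[/eqP e00|]|/eqP Q0].
- move: det en; rewrite e00 mulr0 => /eqP.
  by rewrite mulf_eq0 (negbTE d0n) => /eqP ->; rewrite eqxx.
- rewrite subr_eq0 => /eqP e0d; move: ed; rewrite e0d.
  move/eqP: det; rewrite e0d [d1 * _]mulrC (inj_eq (mulfI d0n)) => /eqP ->.
  by rewrite eqxx.
(* If Q(d) = 0 then B(d) = 0 too, and the discriminant identity makes d parallel to p; since Q(p) =
   1, this forces [d0 = 0]. *)
have /eqP : (a ^+ 2 - 4) * (x * d1 - y * d0) ^+ 2 = 0.
  transitivity (B d0 d1 ^+ 2 - 4 * (x ^+ 2 + y ^+ 2 - a * x * y) * Q d0 d1).
    by rewrite /B /Q; ring.
  by rewrite Bd Q0; ring.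
have a4 := sqr_neq4 a3.
rewrite mulf_eq0 (negbTE a4) expf_eq0 /= subr_eq0 => /eqP xd.
have /eqP : d0 ^+ 2 = 0.
  transitivity (d0 ^+ 2 * (x ^+ 2 + y ^+ 2 - a * x * y)); first by rewrite N0 mulr1.
  transitivity (d0 ^+ 2 * x ^+ 2 + (y * d0) ^+ 2 - a * x * d0 * (y * d0)); first by ring.
  rewrite -xd; transitivity (x ^+ 2 * Q d0 d1); first by rewrite /Q; ring.
  by rewrite Q0 mulr0.
by rewrite expf_eq0 /= (negbTE d0n).
Qed.

(* A line meets the anisotropic conic x^2 - axy + y^2 = 1 in at most two points. *)
Lemma conic_line (a x y d0 d1 e0 e1 : int) : 3 <= a ->
  x ^+ 2 + y ^+ 2 - a * x * y = 1 ->
  (x + d0) ^+ 2 + (y + d1) ^+ 2 - a * (x + d0) * (y + d1) = 1 ->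
  (x + e0) ^+ 2 + (y + e1) ^+ 2 - a * (x + e0) * (y + e1) = 1 ->
  d0 * e1 = d1 * e0 -> (d0, d1) != (0, 0) -> (e0, e1) != (0, 0) ->
  (e0, e1) != (d0, d1) -> False.
Proof.
move=> a3 N0 Nd Ne det; have [d00|d0n _] := eqVneq d0 0; last first.
  exact: (conic_line_aux a3 N0 Nd Ne det d0n).
have [d10|d1n _] := eqVneq d1 0; first by rewrite d00 d10 eqxx.
have sw u v : (u ^+ 2 + v ^+ 2 - a * u * v = v ^+ 2 + u ^+ 2 - a * v * u) by ring.
rewrite sw in N0; rewrite sw in Nd; rewrite sw in Ne.
move=> en ed; apply: (conic_line_aux a3 N0 Nd Ne (esym det) d1n).
- by apply: contraNneq en => -[-> ->].
- by apply: contraNneq ed => -[-> ->].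
Qed.

(** As a >= 3, F_(k+2) >= 3F_(k+1) - F_k >= 2F_(k+1); the exceptional case in the third clause is
    the start (0, 1) of the sequence. *)
Lemma Fseq_spec (a : int) k : 3 <= a ->
  [/\ 0 <= Fseq a k, 2 * Fseq a k <= Fseq a k.+1 &
    3 <= Fseq a k.+1 \/ Fseq a k = 0 /\ Fseq a k.+1 = 1].
Proof.
move=> a3; have [F0 F1 FS] := FseqE a.
elim: k => [|k [IH0 IH1 IH2]]; first by rewrite F0 F1; split=> //; right.
have Fpos : 1 <= Fseq a k.+1 by case: IH2 => [|[_ ->]] //; lia.
have step : 3 * Fseq a k.+1 <= a * Fseq a k.+1 by rewrite ler_pM2r //; lia.
by rewrite FS; split; [lia|lia|left; case: IH2 => [|[-> ->]]; lia].
Qed.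

(** * Rank two: reflections, norms and vanishing weight spaces *)

Section RankTwo.
Variables (K : numClosedFieldType) (a : int).
Hypothesis a3 : 3 <= a.
Local Notation A := (cartan2 a).
Local Notation km := (km K A).
Local Notation h := (@km_h K 2 A).
Local Notation wt := (weight A (@lie K 2 A) h).
Let hL := km_bracket K A.

Lemma ord2 (i : 'I_2) : i = 0 \/ i = 1.
Proof. by case: i => [[|[|i]] //= lti]; [left|right]; apply: val_inj. Qed.

Lemma sum_ord2 (V : nmodType) (F : 'I_2 -> V) : \sum_(i < 2) F i = F 0 + F 1.
Proof.
by rewrite !big_ord_recl big_ord0 addr0; congr (_ + F _); apply: val_inj.
Qed.

Lemma pairing_0 g : pairing A 0 g = 2 * g 0 0 - a * g 0 1.
Proof. by rewrite /pairing sum_ord2 !mxE /= mulNr. Qed.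

Lemma pairing_1 g : pairing A 1 g = 2 * g 0 1 - a * g 0 0.
Proof. by rewrite /pairing sum_ord2 !mxE /= mulNr addrC. Qed.

Lemma bilE g g' : bil A g g' =
  g 0 0 * (2 * g' 0 0 - a * g' 0 1) + g 0 1 * (2 * g' 0 1 - a * g' 0 0).
Proof. by rewrite /bil sum_ord2 pairing_0 pairing_1. Qed.

Lemma row2P (g g' : 'rV[int]_2) : g 0 0 = g' 0 0 -> g 0 1 = g' 0 1 -> g = g'.
Proof. by move=> g0 g1; apply/rowP => i; case: (ord2 i) => ->. Qed.

Lemma reflection_0 g : ((reflection A 0 g 0 0 = a * g 0 1 - g 0 0) *
  (reflection A 0 g 0 1 = g 0 1))%type.
Proof. by rewrite /reflection pairing_0 !mxE /=; split; ring. Qed.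

Lemma reflection_1 g : ((reflection A 1 g 0 0 = g 0 0) *
  (reflection A 1 g 0 1 = a * g 0 0 - g 0 1))%type.
Proof. by rewrite /reflection pairing_1 !mxE /=; split; ring. Qed.

Lemma reflectionK i g : reflection A i (reflection A i g) = g.
Proof.
case: (ord2 i) => ->; apply: row2P.
- by rewrite !reflection_0; ring.
- by rewrite !reflection_0.
- by rewrite !reflection_1.
- by rewrite !reflection_1; ring.
Qed.

Lemma bil_reflection i g g' : bil A (reflection A i g) (reflection A i g') = bil A g g'.
Proof.
by rewrite !bilE; case: (ord2 i) => ->; rewrite ?reflection_0 ?reflection_1; ring.
Qed.

Lemma cartan2_inj g : (forall i, pairing A i g = 0) -> g = 0.
Proof.
move=> g0; have := g0 0; have := g0 1; rewrite pairing_0 pairing_1 => e1 e0.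
have a4 := sqr_neq4 a3.
apply: row2P; rewrite mxE; apply: (mulfI a4); rewrite mulr0.
  transitivity (- 2 * (2 * g 0 0 - a * g 0 1) - a * (2 * g 0 1 - a * g 0 0)); first by ring.
  by rewrite e0 e1; ring.
transitivity (- 2 * (2 * g 0 1 - a * g 0 0) - a * (2 * g 0 0 - a * g 0 1)); first by ring.
by rewrite e0 e1; ring.
Qed.

Lemma cartan2_diag i : A i i = 2.
Proof. by rewrite mxE eqxx. Qed.

Lemma cartan2_sym i j : A i j = A j i.
Proof. by rewrite !mxE eq_sym. Qed.

Lemma cartan2_neg i j : i != j -> A i j <= 0.
Proof. by rewrite mxE => /negbTE ->; rewrite oppr_le0; lia. Qed.

Lemma real_root_norm g : real_root K A g -> bil A g g = 2.
Proof.
move=> [_ [w [j ->]]]; elim: w => [|i w IHw] /=; last by rewrite bil_reflection.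
by rewrite bilE; case: (ord2 j) => ->; rewrite !mxE /=; ring.
Qed.

Variable omega : km -> km.
Hypothesis homega : compact_involution omega.

Lemma real_vector_bracket g x : real_root K A g -> wt g x -> x != 0 ->
  exists2 p : K, 0 < p & lie x (omega x) = - p *: coroot K A g.
Proof.
move=> [_ [w [j ->]]].
exact: (real_root_bracket homega cartan2_inj cartan2_diag cartan2_sym cartan2_neg).
Qed.

(** The rotation carries the weight space of [g] injectively into that of its reflection. *)
Lemma weight_reflection i g x : wt g x ->
  (forall y, wt (reflection A i g) y -> y = 0) -> x = 0.
Proof.
move=> wx y0.
have [y rxy] := rotation_ex homega cartan2_inj cartan2_diag cartan2_sym cartan2_neg i x.
apply: (rotation_inj hL rxy); rewrite (y0 y); first by apply: rotation_fix; rewrite (br0r hL).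
by apply: (rotation_weight cartan2_diag _ rxy); rewrite reflectionK.
Qed.

(** Descent on the height. If a coordinate is 0, [g] is a multiple c alpha_j with c > 1. Otherwise
    some simple reflection lowers the height and keeps the norm; its result either has mixed signs
    or is covered by induction. *)
Lemma weight_norm_nonneg (g : 'rV[int]_2) x : 0 <= g 0 0 -> 0 <= g 0 1 -> 2 < bil A g g ->
  wt g x -> x = 0.
Proof.
move: {2}(absz _) (leqnn (absz (g 0 0 + g 0 1))) => m.
elim: m g x => [|m IHm] g x; move=> gm g0 g1 gg wx.
  have [e0 e1] : g 0 0 = 0 /\ g 0 1 = 0 by lia.
  by move: gg; rewrite bilE e0 e1; lia.
have [e0|n0] := eqVneq (g 0 0) 0.
  have gE : g = g 0 1 *: simple_root 1.
    by apply: row2P; rewrite !mxE /= ?mulr0 ?mulr1.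
  rewrite gE in wx; apply: (weight_multiple cartan2_inj _ wx).
  move: gg; rewrite bilE e0 mul0r add0r mulr0 subr0 ltNge => gg.
  rewrite ltNge; apply: contraNN gg => le1.
  by have [->|->] : g 0 1 = 0 \/ g 0 1 = 1 by lia.
have [e1|n1] := eqVneq (g 0 1) 0.
  have gE : g = g 0 0 *: simple_root 0.
    by apply: row2P; rewrite !mxE /= ?mulr0 ?mulr1.
  rewrite gE in wx; apply: (weight_multiple cartan2_inj _ wx).
  move: gg; rewrite bilE e1 mul0r addr0 mulr0 subr0 ltNge => gg.
  rewrite ltNge; apply: contraNN gg => le1.
  by have [->|->] : g 0 0 = 0 \/ g 0 0 = 1 by lia.
have [c0|c0] := ltP 0 (2 * g 0 0 - a * g 0 1).
  apply: (weight_reflection (i := 0)) wx _ => y wy.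
  have [r0 r1] := reflection_0 g.
  have [s0|s0] := ltP (reflection A 0 g 0 0) 0.
    by apply: (weight_mixed cartan2_inj (k := 0) (l := 1)) wy => //; rewrite r1; lia.
  by apply: IHm wy => //; rewrite ?bil_reflection ?r0 ?r1 //; lia.
(* The norm is the sum of the coordinates times the pairings, so the two pairings cannot both be
   nonpositive. *)
have c1 : 0 < 2 * g 0 1 - a * g 0 0.
  rewrite ltNge; apply/negP => c1; move: gg; rewrite bilE.
  have := mulr_ge0_le0 g0 c0; have := mulr_ge0_le0 g1 c1; lia.
apply: (weight_reflection (i := 1)) wx _ => y wy.
have [r0 r1] := reflection_1 g.
have [s0|s0] := ltP (reflection A 1 g 0 1) 0.
  by apply: (weight_mixed cartan2_inj (k := 1) (l := 0)) wy => //; rewrite r0; lia.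
by apply: IHm wy => //; rewrite ?bil_reflection ?r0 ?r1 //; lia.
Qed.

(** [omega] exchanges [g] and [- g], which leaves the nonnegative case; mixed signs never occur
    among weights. *)
Lemma weight_norm (g : 'rV[int]_2) x : 2 < bil A g g -> wt g x -> x = 0.
Proof.
move=> gg wx.
have neg : g 0 0 <= 0 -> g 0 1 <= 0 -> x = 0.
  move=> g0 g1; apply: (omega_eq0 homega).
  apply: (weight_norm_nonneg (g := - g)); rewrite ?mxE ?oppr_ge0 //.
    by have <- : bil A g g = bil A (- g) (- g) by rewrite !bilE !mxE; ring.
  exact: weight_omega.
have mixed k l : g 0 k < 0 -> 0 < g 0 l -> x = 0.
  by move=> gk gl; apply: (weight_mixed cartan2_inj gk gl wx).
case: (ltgtP (g 0 0) 0) => g0; case: (ltgtP (g 0 1) 0) => g1;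
  by [apply: mixed g0 g1|apply: mixed g1 g0|apply: neg; lia
     |apply: weight_norm_nonneg gg wx; lia].
Qed.

(** * Triples of length two *)

Lemma cross_bracket0 g g' x x' : bil A g g = 2 -> bil A g' g' = 2 ->
  bil A g g' <= -3 -> wt g x -> wt g' x' -> lie x (omega x') = 0.
Proof.
move=> gg gg' gg3 wx wx'.
have := weight_br (km_chevalley K A) wx (weight_omega homega wx').
apply: weight_norm.
have -> : bil A (g - g') (g - g') = bil A g g + bil A g' g' - 2 * bil A g g'.
  by rewrite !bilE !mxE; ring.
by rewrite gg gg'; lia.
Qed.

Lemma length2_triple g0 g1 E0 E1 :
  real_positive_vector_of g0 E0 -> real_positive_vector_of g1 E1 ->
  bil A g0 g1 <= -3 ->
  exists c0 c1 : K, let X := c0 *: E0 + c1 *: E1 in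
    has_length X 2 /\ sl2_triple X (omega X) (lie X (omega X)).
Proof.
move=> [rr0 [[g0n _] g0p] E0n rs0] [rr1 [[g1n _] g1p] E1n rs1] b3.
have w0 := iffLR (root_space_weight _ _) rs0.
have w1 := iffLR (root_space_weight _ _) rs1.
have [p0 p0p H0] := real_vector_bracket rr0 w0 E0n.
have [p1 p1p H1] := real_vector_bracket rr1 w1 E1n.
have n0 := real_root_norm rr0; have n1 := real_root_norm rr1.
have bC : bil A g1 g0 = bil A g0 g1 by rewrite !bilE; ring.
pose m : K := (- bil A g0 g1)%:~R.
have m2 : 0 < m - 2.
  by rewrite /m -[2]/(2%:~R) -rmorphB /= ltr0z; lia.
(* Each g_i has pairing 2 - m with (g0 + g1)^vee, so -q (g0 + g1)^vee acts on both E_i by q(m - 2),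
   which must be 2. *)
pose q : K := 2 / (m - 2).
have q0 : 0 < q by rewrite divr_gt0 // ltr0n.
(* The coefficients have to satisfy |c_i|^2 p_i = q. *)
have normC p : 0 < p -> sqrtC (q / p) * (sqrtC (q / p))^* * p = q.
  move=> p0'; rewrite -normCK -normrX sqrtCK ger0_norm ?divfK ?gt_eqF //.
  by rewrite ltW // divr_gt0.
have cn p : 0 < p -> sqrtC (q / p) != 0.
  by move=> p0'; rewrite sqrtC_eq0 mulf_neq0 ?invr_eq0 ?gt_eqF.
exists (sqrtC (q / p0)), (sqrtC (q / p1)).
set c0 := sqrtC (q / p0); set c1 := sqrtC (q / p1) => X.
have HE : lie X (omega X) = - q *: (coroot K A g0 + coroot K A g1).
  rewrite /X (omegaD homega) !(omegaZ homega) (br_Dl hL) !(br_Dr hL).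
  rewrite !(br_Zl hL) !(br_Zr hL) (cross_bracket0 n0 n1 b3 w0 w1).
  rewrite (cross_bracket0 n1 n0 _ w1 w0) ?bC // !scaler0 addr0 add0r H0 H1.
  rewrite !scalerA !mulrN /c0 /c1 !normC //.
  by rewrite scalerDr.
have weq g x : wt g x -> bil A g0 g + bil A g1 g = 2 + bil A g0 g1 ->
    lie (lie X (omega X)) x = 2 *: x.
  move=> wx gE; rewrite HE (br_Zl hL) (br_Dl hL) !(lie_coroot _ wx) -scalerDl.
  rewrite -intrD gE scalerA; congr (_ *: _).
  have -> : (2 + bil A g0 g1)%:~R = - (m - 2) :> K.
    by rewrite /m opprB rmorphN opprK rmorphD.
  by rewrite mulrNN /q divfK ?gt_eqF.
have HX : lie (lie X (omega X)) X = 2 *: X.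
  rewrite {2 3}/X (br_Dr hL) !(br_Zr hL) (weq g0) ?(weq g1) ?n0 ?n1 ?bC ?[_ + 2]addrC //.
  by rewrite scalerDr !scalerA ![2 * _]mulrC.
have g01 : g0 != g1 by apply: contraTneq b3 => ->; rewrite n1.
(* The two summands have different weights, so they cannot cancel. *)
have X0 : X != 0.
  apply: contra_neq (_ : c0 *: E0 != 0); last by rewrite scaler_eq0 negb_or cn.
  move=> X0; apply/esym.
  apply: (@eigen_sep _ _ 'I_2 unit (fun i => lie (h i)) _ _
    (fun _ i => (pairing A i g1)%:~R) (fun i => (pairing A i g0)%:~R)
    (fun=> c1 *: E1) 0 _ [:: tt]).
  - by move=> *; rewrite (br_Dr hL).
  - by move=> *; rewrite (br_Zr hL).
  - by move=> i; rewrite (br0r hL) scaler0.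
  - exact/(weightZ (km_chevalley K A)).
  - by move=> _; apply/(weightZ (km_chevalley K A)).
  - move=> j _ t0; apply: contrapT => /forallNP E; case/eqP: g01.
    apply/esym/eqP; rewrite -subr_eq0; apply/eqP/cartan2_inj => i.
    apply/eqP; rewrite pairingD pairingN subr_eq0.
    by have /negP := E i; rewrite negbK eqr_int.
  - by rewrite big_seq1.
have h0 : lie X (omega X) != 0.
  apply: contra_neq X0 => H; move: HX; rewrite H (br0l hL) => /esym/eqP.
  by rewrite scaler_eq0 pnatr_eq0 /= => /eqP.
(* H is a real combination of the [h i]; applying [omega] to [H, X] = 2X then gives [H, Y] = -2Y. *)
have oH : omega (lie X (omega X)) = - lie X (omega X).
  have oc g : omega (coroot K A g) = - coroot K A g.
    by apply: (omega_hR homega) => i; rewrite realz.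
  have qr : (- q)^* = - q by rewrite conj_Creal // rpredN gtr0_real.
  by rewrite HE (omegaZ homega) (omegaD homega) !oc qr -opprD scalerN.
split.
  exists (fun i : 'I_2 => if i == 0 then g0 else g1),
    (fun i : 'I_2 => if i == 0 then c0 else c1),
    (fun i : 'I_2 => if i == 0 then E0 else E1); split.
  - move=> i j; case: (ord2 i) => ->; case: (ord2 j) => -> //= /eqP.
      by rewrite (negbTE g01).
    by rewrite eq_sym (negbTE g01).
  - by move=> i; case: (i == 0).
  - by move=> i; case: (i == 0); [apply: (cn p0)|apply: (cn p1)].
  - by move=> i; case: (i == 0).
  - by rewrite sum_ord2.
have [_ NP _] := lie_subalgebra_nplus K A.
have nX : nplus X.
  apply: (NP); first exact: (weight_nplus cartan2_inj g0p g0n w0).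
  rewrite -[_ *: _]addr0; apply: (NP); last by move=> B [[]].
  exact: (weight_nplus cartan2_inj g1p g1n w1).
split; split=> //.
- by apply: contra_neq X0 => /(omega_eq0 homega).
- exact: nplus_omega.
- rewrite HE /cartan /=.
  exists (fun i => - q * ((g0 0 i)%:~R + (g1 0 i)%:~R)).
  rewrite /coroot -big_split scaler_sumr; apply: eq_bigr => i _ /=.
  by rewrite -scalerDl scalerA.
- have /(congr1 omega) := HX; rewrite (omega_lieE homega) oH (omegaZ homega).
  rewrite (brNl hL) conj_Creal ?realn // => /eqP; rewrite eqr_oppLR => /eqP ->.
  by rewrite scaleNr.
Qed.

(** With y = F_(k+1), x = F_k, w = F_(l+1), z = F_l, the bounds 2x <= y and 2z <= w show that the
    negated form is at least (a - 2)yw. This is at least 3 unless k = l = 0, where the form equals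
    -a. *)
Lemma alpha_beta_bil g g' : alpha_root a g -> beta_root a g' -> bil A g g' <= -3.
Proof.
move=> [k ->] [l ->]; rewrite bilE !mxE /= !mulr0 !mulr1 !addr0 !add0r.
have [x0 xy y1] := Fseq_spec k a3; have [z0 zw w1] := Fseq_spec l a3.
move: (Fseq a k) (Fseq a k.+1) (Fseq a l) (Fseq a l.+1) x0 xy y1 z0 zw w1 => x y z w.
move=> x0 xy y1 z0 zw w1.
suff : 3 <= a * (y * w + x * z) - 2 * (y * z + x * w) by lia.
have [yw|[[-> ->] [-> ->]]] : 3 <= y * w \/ (x = 0 /\ y = 1) /\ (z = 0 /\ w = 1).
- case: y1 => [y3|[-> ->]]; case: w1 => [w3|[-> ->]]; [left|left; lia|left; lia|by right].
  by apply: le_trans y3 _; rewrite ler_peMr //; lia.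
- have E1 : 0 <= y * (w - 2 * z) by apply: mulr_ge0; case: y1; lia.
  have E2 : 0 <= w * (y - 2 * x) by apply: mulr_ge0; case: w1; lia.
  have E3 : 0 <= (a - 3) * (y * w) by apply: mulr_ge0; lia.
  have E4 : 0 <= a * (x * z) by apply: mulr_ge0; [lia|apply: mulr_ge0].
  by lia.
- by lia.
Qed.

(** * Exclusion of the other lengths *)

Lemma real_span_decomposition X : real_positive_span X ->
  exists (D : seq 'rV[int]_2) (Z : 'rV[int]_2 -> km),
    [/\ uniq D, (forall g, g \in D -> [/\ real_root K A g, Z g != 0 & wt g (Z g)])
      & X = \sum_(g <- D) Z g].
Proof.
move=> [m [c [E [rE ->]]]].
have [G HG] := fin_all_exists rE.
(* Terms are collected by root, coefficients included; roots whose terms cancel are filtered out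
   below. *)
pose Z g := \sum_(i < m | G i == g) c i *: E i.
pose D := [seq G i | i <- enum 'I_m].
exists [seq g <- undup D | Z g != 0], Z; split.
- by rewrite filter_uniq ?undup_uniq.
- move=> g; rewrite mem_filter mem_undup => /andP[Zg /mapP[i _ gE]].
  split=> //; first by rewrite gE; case: (HG i).
  apply: (big_ind (wt g)) => [|x y|k /eqP <-].
  + exact: (weight0 (km_chevalley K A)).
  + exact: (weightD (km_chevalley K A)).
  + apply/(weightZ (km_chevalley K A))/root_space_weight; by case: (HG k).
rewrite big_filter [RHS]big_mkcond /=.
transitivity (\sum_(g <- undup D) \sum_(i < m | G i == g) c i *: E i); last first.
  by apply: eq_bigr => g _; rewrite -/(Z g); case: eqP => // ->.
under [RHS]eq_bigr do rewrite big_mkcond.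
rewrite exchange_big; apply: eq_bigr => i _ /=.
have iD : G i \in undup D by rewrite mem_undup map_f ?mem_enum.
rewrite (bigD1_seq (G i) iD (undup_uniq _)) /= eqxx.
by rewrite big1 ?addr0 // => g /negbTE; rewrite eq_sym => ->.
Qed.

Lemma not_triple X : X != 0 -> real_positive_span X -> ~ has_length X 2 ->
  ~ sl2_triple X (omega X) (lie X (omega X)).
Proof.
move=> X0 /real_span_decomposition [D [Z [uD DZ XE]]] len [_ [_ _ [c HE]] [HX _ _]].
pose phi g : K := \sum_(i < 2) c i * (pairing A i g)%:~R.
have HZ g : g \in D -> lie (lie X (omega X)) (Z g) = phi g *: Z g.
  by case/DZ => _ _ wZ; rewrite HE; apply/(iffRL (root_space_weight _ _)).
have sumE : \sum_(g <- D) phi g *: Z g = 2 *: X.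
  rewrite -HX; move: (lie X (omega X)) HZ => H HZ; rewrite XE (br_sumr hL).
  by rewrite big_seq [RHS]big_seq; apply: eq_bigr => g /HZ.
(* The terms of [H, X] - 2X = 0 have distinct weights, so each vanishes separately. *)
have phi2 g : g \in D -> phi g = 2.
  move=> gD; have [_ Zg wg] := DZ _ gD.
  apply/eqP; rewrite -subr_eq0; have /eqP : (phi g - 2) *: Z g = 0; last first.
    by rewrite scaler_eq0 (negbTE Zg) orbF.
  pose D' := [seq g' <- D | g' != g].
  (* [eigen_sep] asks for an eigenvector at every index, hence the default 0 outside [D]. *)
  pose Z' g' := if g' \in D then (phi g' - 2) *: Z g' else 0.
  have wZ' g' : wt g' (Z' g').
    rewrite /Z'; case: ifP => [/DZ[_ _ ?]|_]; last exact: (weight0 (km_chevalley K A)).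
    exact/(weightZ (km_chevalley K A)).
  apply/esym/(@eigen_sep _ _ 'I_2 'rV[int]_2 (fun i => lie (h i)) _ _
    (fun g' i => (pairing A i g')%:~R) (fun i => (pairing A i g)%:~R) Z' 0 _ D').
  - by move=> *; rewrite (br_Dr hL).
  - by move=> *; rewrite (br_Zr hL).
  - by move=> i; rewrite (br0r hL) scaler0.
  - exact/(weightZ (km_chevalley K A)).
  - by [].
  - move=> j jD t0; apply: contrapT => /forallNP E.
    have /(all_nthP t0)/(_ _ jD)/negP := filter_all (fun g' => g' != g) D; apply.
    rewrite -subr_eq0; apply/eqP/cartan2_inj => i.
    apply/eqP; rewrite pairingD pairingN subr_eq0.
    by have /negP := E i; rewrite negbK eqr_int.
  - rewrite /D' big_filter; transitivity (\sum_(g' <- D) Z' g').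
      rewrite /Z' big_seq (eq_bigr (fun g' => phi g' *: Z g' - 2 *: Z g')); last first.
        by move=> g' ->; rewrite scalerBl.
      rewrite sumrB -scaler_sumr -!big_seq.
      by rewrite sumE -XE subrr.
    by rewrite (bigD1_seq g) //= {1}/Z' gD.
case: D uD DZ XE phi2 {HZ sumE} => [|g1 [|g2 [|g3 D]]] uD DZ XE phi2.
- by rewrite XE big_nil eqxx in X0.
- have [rr Zg wZ] := DZ g1 (mem_head _ _).
  rewrite big_seq1 in XE; rewrite -XE in wZ.
  have [p p0 pE] := real_vector_bracket rr wZ X0.
  move: HX; rewrite pE (br_Zl hL) (lie_coroot _ wZ) (real_root_norm rr) scalerA.
  move=> /eqP; rewrite -subr_eq0 -scalerBl scaler_eq0 (negbTE X0) orbF.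
  rewrite subr_eq0 mulNr => /eqP E.
  have : - (p * 2%:~R) < 0 by rewrite oppr_lt0 mulr_gt0 // ltr0z.
  by rewrite E le_gtF ?ler0n.
- apply: len; have := uD; rewrite /= inE andbT => g12.
  have [rr1 Zg1 wZ1] := DZ g1 (mem_head _ _).
  have [rr2 Zg2 wZ2] : [/\ real_root K A g2, Z g2 != 0 & wt g2 (Z g2)].
    by apply: DZ; rewrite !inE eqxx orbT.
  exists (fun i : 'I_2 => if i == 0 then g1 else g2), (fun=> 1),
    (fun i : 'I_2 => if i == 0 then Z g1 else Z g2); split.
  + move=> i j; case: (ord2 i) => ->; case: (ord2 j) => -> //= /eqP.
      by rewrite (negbTE g12).
    by rewrite eq_sym (negbTE g12).
  + by move=> i; case: (i == 0).
  + by move=> i; rewrite oner_eq0.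
  + by move=> i; case: (i == 0); split=> //; apply/root_space_weight.
  + by rewrite XE sum_ord2 !scale1r big_cons big_seq1.
have [m1 m2 m3] : [/\ g1 \in [:: g1, g2, g3 & D], g2 \in [:: g1, g2, g3 & D]
    & g3 \in [:: g1, g2, g3 & D]] by rewrite !inE !eqxx !orbT.
have N g : g \in [:: g1, g2, g3 & D] ->
    g 0 0 ^+ 2 + g 0 1 ^+ 2 - a * g 0 0 * g 0 1 = 1.
  move=> /DZ[/real_root_norm]; rewrite bilE => gg _ _.
  by apply: (mulfI (_ : 2 != 0 :> int)) => //; rewrite -[RHS]gg; ring.
move: uD; rewrite /= !inE !negb_or => /andP[/and3P[g12 g13 _] /andP[/andP[g23 _] _]].
(* [P] and [Q] are the coefficients of the linear form [phi] in the coordinates of the root; they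
   are not both 0 because [phi] takes the value 2. *)
pose P : K := 2 * c 0 - a%:~R * c 1; pose Q : K := 2 * c 1 - a%:~R * c 0.
have phiE g : phi g = P * (g 0 0)%:~R + Q * (g 0 1)%:~R.
  rewrite /phi sum_ord2 /P /Q.
  by rewrite pairing_0 pairing_1 !rmorphB !rmorphM /=; ring.
have phi_diff g : g \in [:: g1, g2, g3 & D] ->
    P * (g 0 0 - g1 0 0)%:~R + Q * (g 0 1 - g1 0 1)%:~R = 0.
  move=> gD; rewrite !rmorphB /=; transitivity (phi g - phi g1); first by rewrite !phiE; ring.
  by rewrite !phi2 // subrr.
have PQ : (P != 0) || (Q != 0).
  rewrite -negb_and; apply/negP => /andP[/eqP P0 /eqP Q0].
  have := phi2 _ m1; rewrite phiE P0 Q0 !mul0r addr0 => /esym/eqP.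
  by rewrite pnatr_eq0.
pose d0 := g2 0 0 - g1 0 0; pose d1 := g2 0 1 - g1 0 1.
pose e0 := g3 0 0 - g1 0 0; pose e1 := g3 0 1 - g1 0 1.
have D1 : P * d0%:~R + Q * d1%:~R = 0 by apply: phi_diff.
have D2 : P * e0%:~R + Q * e1%:~R = 0 by apply: phi_diff.
(* Both difference vectors lie in the kernel of the nonzero form (P, Q), so they are parallel. *)
have det : d0 * e1 = d1 * e0.
  apply/eqP; rewrite -subr_eq0 -(intr_eq0 K) rmorphB !rmorphM /=.
  have EP : P * (d0%:~R * e1%:~R - d1%:~R * e0%:~R) = 0.
    transitivity ((P * d0%:~R + Q * d1%:~R) * e1%:~R -
      (P * e0%:~R + Q * e1%:~R) * d1%:~R); first by ring.
    by rewrite D1 D2 !mul0r subrr.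
  have EQ : Q * (d0%:~R * e1%:~R - d1%:~R * e0%:~R) = 0.
    transitivity ((P * e0%:~R + Q * e1%:~R) * d0%:~R -
      (P * d0%:~R + Q * d1%:~R) * e0%:~R); first by ring.
    by rewrite D1 D2 !mul0r subrr.
  by case/orP: PQ => nz; apply/eqP/(mulfI nz); rewrite mulr0.
have N2 := N _ m2; have N3 := N _ m3.
have e2 : ((g2 0 0 = (g1 0 0 + d0)%R) * (g2 0 1 = (g1 0 1 + d1)%R))%type.
  by split; rewrite addrC subrK.
have e3 : ((g3 0 0 = (g1 0 0 + e0)%R) * (g3 0 1 = (g1 0 1 + e1)%R))%type.
  by split; rewrite addrC subrK.
rewrite !e2 in N2; rewrite !e3 in N3.
apply: (conic_line a3 (N _ m1) N2 N3 det).
- by apply: contra_neq g12 => -[d00 d10]; apply: row2P; rewrite e2 ?d00 ?d10 addr0.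
- by apply: contra_neq g13 => -[d00 d10]; apply: row2P; rewrite e3 ?d00 ?d10 addr0.
- by apply: contra_neq g23 => -[d00 d10]; apply: row2P; rewrite e2 e3 ?d00 ?d10.
Qed.

End RankTwo.

(** * Both statements over the complex numbers *)

Local Open Scope complex_scope.

Theorem theorem5p8 (R : realType) (a : int) (ha : 3 <= a)
    (omega : km R[i] (cartan2 a) -> km R[i] (cartan2 a))
    (homega : compact_involution omega) :
  (forall X : km R[i] (cartan2 a),
     X != 0 -> real_positive_span X -> ~ has_length X 2 ->
     ~ sl2_triple X (omega X) (lie X (omega X)))
  /\
  (forall E0 E1 : km R[i] (cartan2 a),
     (alpha_type E0 /\ beta_type E1) \/ (beta_type E0 /\ alpha_type E1) ->
     exists c0 c1 : R[i],
       let X := c0 *: E0 + c1 *: E1 in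
       has_length X 2 /\ sl2_triple X (omega X) (lie X (omega X))).
Proof.
split=> [X|E0 E1]; first exact: (not_triple ha homega).
case=> [[[g0 [v0 t0]] [g1 [v1 t1]]]|[[g0 [v0 t0]] [g1 [v1 t1]]]].
  exact: (length2_triple ha homega v0 v1 (alpha_beta_bil ha t0 t1)).
apply: (length2_triple ha homega v0 v1).
suff -> : bil (cartan2 a) g0 g1 = bil (cartan2 a) g1 g0 by apply: alpha_beta_bil.
by rewrite !bilE; ring.
Qed.
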